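(* Let $\gamma$ be an ordinal and let $\mathbb{P}=\prod_{\alpha<\gamma}\mathbb{P}_\alpha$ be a product forcing of bounded support; that is, $p\in\mathbb{P}$ only if there is $\delta<\gamma$ such that $p=p\upharpoonright\delta$. If $\mathbb{P}$ has the $\operatorname{cf}(\gamma)$-chain condition then $\mathbb{P}$ is $\operatorname{cf}(\gamma)$-final.
   Context: A notion of forcing is a partially ordered set with a maximal element $\mathbb{1}$; $q\leq p$ means $q$ is stronger than $p$. Given notions of forcing $\{\mathbb{P}_i: i\in I\}$, a product forcing $\mathbb{P}=\prod_{i\in I}\mathbb{P}_i$ is a notion of forcing $\mathbb{P}$ such that: each $p\in\mathbb{P}$ is a function with domain $I$ and $p(i)\in\mathbb{P}_i$ for all $i$; every such function with finite support $\operatorname{supp}(p)=\{i\in I: p(i)\neq\mathbb{1}_{\mathbb{P}_i}\}$ is in $\mathbb{P}$; $q\leq p$ iff $q(i)\leq p(i)$ for all $i$; if $p,p'\in\mathbb{P}$ have disjoint supports then the function $i\mapsto\min\{p(i),p'(i)\}$ is in $\mathbb{P}$; and for $p\in\mathbb{P}$, $I_0\subseteq I$, the function $p\upharpoonright I_0$ that agrees with $p$ on $I_0$ and equals $\mathbb{1}_{\mathbb{P}_i}$ for $i\notin I_0$ is in $\mathbb{P}$. $\mathbb{P}\upharpoonright I_0=\{p\upharpoonright I_0: p\in\mathbb{P}\}$. For $I=\gamma$ an ordinal, $\alpha\leq\gamma$, and $G\subseteq\mathbb{P}$ a $V$-generic filter, $G\upharpoonright\alpha=\{p\upharpoonright\alpha: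 p\in G\}$, a $V$-generic filter for $\mathbb{P}\upharpoonright\alpha$. $\mathbb{P}$ has the $\kappa$-chain condition if for every $A\subseteq\mathbb{P}$ with $|A|\geq\kappa$ there are distinct compatible $p,p'\in A$ (every antichain has cardinality less than $\kappa$). $\mathbb{P}=\prod_{\alpha<\gamma}\mathbb{P}_\alpha$ is $\kappa$-final if for all $V$-generic $G\subseteq\mathbb{P}$ and all $\eta<\kappa$, $(V^\eta)^{V[G]}=\bigcup_{\alpha<\gamma}(V^\eta)^{V[G\upharpoonright\alpha]}$; that is, every function $\eta\to V$ in $V[G]$ belongs to $V[G\upharpoonright\alpha]$ for some $\alpha<\gamma$. *)

(* Defs.v *)
From Stdlib Require Import Classical FunctionalExtensionality PropExtensionality.
From Stdlib Require Import ProofIrrelevance IndefiniteDescription Wellfounded.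

Set Implicit Arguments.
Unset Strict Implicit.
Unset Printing Implicit Defensive.

(** * Structures for the language of set theory *)

Structure eps_struct := EpsStruct {
  carrier :> Type;
  mem : carrier -> carrier -> Prop
}.
Arguments mem {_} _ _.

Declare Scope eps_scope.
Delimit Scope eps_scope with eps.
Open Scope eps_scope.
Notation "x ∈ y" := (mem x y) (at level 70, no associativity) : eps_scope.

(** Every notion below is the usual set-theoretic formula read in the structure
    [M]: quantifiers over [M] are the quantifiers of that formula, so for [M] a
    model of ZFC these are the relativized notions. *)

Section SetNotions.
Context {M : eps_struct}.
Implicit Types a b c d f i n p q r s x y z : M.

Definition subset x y : Prop := forall z, z ∈ x -> z ∈ y.
Definition is_empty x : Prop := forall z, ~ z ∈ x.
Definition is_succ y x : Prop := forall z, z ∈ y <-> z ∈ x \/ z = x.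

(** [c = {a, b}] and the Kuratowski pair [c = (a, b)]. *)
Definition is_upair c a b : Prop := forall z, z ∈ c <-> z = a \/ z = b.
Definition is_opair c a b : Prop :=
  forall z, z ∈ c <-> is_upair z a a \/ is_upair z a b.

(** [(a, b) ∈ r]; when [r] is a function, [r(a) = b]. *)
Definition related r a b : Prop := exists z, is_opair z a b /\ z ∈ r.

Definition is_function f d : Prop :=
  (forall z, z ∈ f -> exists a b, a ∈ d /\ is_opair z a b) /\
  (forall a, a ∈ d -> exists! b, related f a b).

Definition maps_into f d c : Prop :=
  is_function f d /\ forall a b, related f a b -> b ∈ c.
Definition is_injection f d c : Prop :=
  maps_into f d c /\
  forall a a' b, related f a b -> related f a' b -> a = a'.
Definition is_bijection f d c : Prop :=
  is_injection f d c /\ forall b, b ∈ c -> exists a, related f a b.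

Definition is_transitive x : Prop := forall y, y ∈ x -> subset y x.

(** The usual definition in the presence of Foundation. *)
Definition is_ordinal x : Prop :=
  is_transitive x /\ forall y, y ∈ x -> is_transitive y.

Definition is_natural n : Prop :=
  is_ordinal n /\
  forall m : M, m = n \/ m ∈ n -> is_empty m \/ exists k, is_succ m k.

Definition is_finite s : Prop :=
  exists n f, is_natural n /\ is_bijection f s n.

(** [|a| >= k]. *)
Definition card_ge a (k : M) : Prop := exists f, is_injection f k a.

Definition is_cofinal_map f (k g : M) : Prop :=
  maps_into f k g /\
  forall b, b ∈ g -> exists x y, related f x y /\ subset b y.

(** [k = cf(g)]; in particular [cf(0) = 0] and [cf(b + 1) = 1]. *)
Definition is_cofinality (k g : M) : Prop :=
  is_ordinal k /\
  (exists f, is_cofinal_map f k g) /\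
  (forall m : M, m ∈ k -> ~ exists f, is_cofinal_map f m g).

Definition well_orders r a : Prop :=
  (forall x, x ∈ a -> ~ related r x x) /\
  (forall x y z, x ∈ a -> y ∈ a -> z ∈ a ->
     related r x y -> related r y z -> related r x z) /\
  (forall x y, x ∈ a -> y ∈ a -> related r x y \/ x = y \/ related r y x) /\
  (forall b, subset b a -> (exists x, x ∈ b) ->
     exists x, x ∈ b /\ forall y, y ∈ b -> y = x \/ related r x y).

End SetNotions.

(** * First-order formulas and ZFC *)

(** De Bruijn indices: [fEx] binds index 0. *)
Inductive formula : Type :=
| fMem (i j : nat)
| fEq (i j : nat)
| fNot (A : formula)
| fAnd (A B : formula)
| fEx (A : formula).

Definition scons (T : Type) (x : T) (e : nat -> T) (n : nat) : T :=
  match n with 0 => x | S m => e m end.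

Fixpoint sat (M : eps_struct) (e : nat -> M) (A : formula) : Prop :=
  match A with
  | fMem i j => e i ∈ e j
  | fEq i j => e i = e j
  | fNot A => ~ sat e A
  | fAnd A B => sat e A /\ sat e B
  | fEx A => exists x : M, sat (scons x e) A
  end.

Record ZFC (M : eps_struct) : Prop := {
  zfc_extensionality : forall x y : M, (forall z, z ∈ x <-> z ∈ y) -> x = y;
  zfc_foundation : forall x : M, (exists y, y ∈ x) ->
    exists y, y ∈ x /\ forall z, ~ (z ∈ x /\ z ∈ y);
  zfc_pairing : forall a b : M, exists c, is_upair c a b;
  zfc_union : forall a : M, exists u,
    forall x, x ∈ u <-> exists y, y ∈ a /\ x ∈ y;
  zfc_power : forall a : M, exists c, forall x, x ∈ c <-> subset x a;
  zfc_infinity : exists w : M,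
    (exists x, x ∈ w /\ is_empty x) /\
    (forall x, x ∈ w -> exists y, y ∈ w /\ is_succ y x);
  zfc_separation : forall (A : formula) (e : nat -> M) (a : M),
    exists b, forall x, x ∈ b <-> x ∈ a /\ sat (scons x e) A;
  zfc_replacement : forall (A : formula) (e : nat -> M) (a : M),
    (forall x, x ∈ a -> exists! y, sat (scons x (scons y e)) A) ->
    exists b, forall x, x ∈ a ->
      exists y, y ∈ b /\ sat (scons x (scons y e)) A;
  zfc_choice : forall a : M, exists r, well_orders r a
}.

(** * The background universe

    The sets of the metatheory: well-founded trees up to extensional equality,
    represented by their equivalence classes so that equality of sets is [=]. *)

Inductive tree : Type := Sup (A : Type) (f : A -> tree).

Fixpoint teq (s t : tree) : Prop :=
  match s, t with
  | Sup f, Sup g =>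
      (forall a, exists b, teq (f a) (g b)) /\
      (forall b, exists a, teq (f a) (g b))
  end.

Definition hset : Type := {C : tree -> Prop | exists t, C = teq t}.

Definition hmem (x y : hset) : Prop :=
  exists (A : Type) (f : A -> tree) (a : A),
    proj1_sig y (Sup f) /\ proj1_sig x (f a).

Definition background : eps_struct := EpsStruct hmem.

Definition hset_of (t : tree) : hset := exist _ (teq t) (ex_intro _ t eq_refl).

Lemma teq_refl t : teq t t.
Proof. induction t as [A f IH]; split; intro a; exists a; apply IH. Qed.

Lemma teq_sym s t : teq s t -> teq t s.
Proof.
revert t; induction s as [A f IH]; intros [B g] [H1 H2]; split.
- intro b; destruct (H2 b) as [a Ha]; exists a; apply IH, Ha.
- intro a; destruct (H1 a) as [b Hb]; exists b; apply IH, Hb.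
Qed.

Lemma teq_trans s t u : teq s t -> teq t u -> teq s u.
Proof.
revert t u; induction s as [A f IH]; intros [B g] [C h] [H1 H2] [H3 H4]; split.
- intro a; destruct (H1 a) as [b Hb], (H3 b) as [c Hc].
  exists c; exact (IH a _ _ Hb Hc).
- intro c; destruct (H4 c) as [b Hb], (H2 b) as [a Ha].
  exists a; exact (IH a _ _ Ha Hb).
Qed.

Lemma hset_ofP (x : hset) : exists t, x = hset_of t.
Proof.
destruct x as [C [t Ht]]; exists t; subst C; unfold hset_of.
f_equal; apply proof_irrelevance.
Qed.

Lemma hset_of_eq s t : hset_of s = hset_of t <-> teq s t.
Proof.
split; intro H.
- apply (f_equal (@proj1_sig _ _)) in H; simpl in H.
  rewrite H; apply teq_refl.
- assert (E : teq s = teq t).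
  { apply functional_extensionality; intro u; apply propositional_extensionality.
    split; intro K; [apply teq_sym in H|]; exact (teq_trans H K). }
  unfold hset_of; generalize (ex_intro (fun t0 => teq s = teq t0) s eq_refl).
  rewrite E; intro e; f_equal; apply proof_irrelevance.
Qed.

Lemma hmem_Sup (x : hset) A (f : A -> tree) :
  hmem x (hset_of (Sup f)) <-> exists a, x = hset_of (f a).
Proof.
destruct (hset_ofP x) as [t ->]; split.
- intros (B & g & b & [_ H2] & Hx); destruct (H2 b) as [a Ha]; exists a.
  apply hset_of_eq; exact (teq_trans Hx (teq_sym Ha)).
- intros [a Ha]; exists A, f, a; split; [apply teq_refl|].
  exact (proj1 (hset_of_eq _ _) Ha).
Qed.

Lemma hset_ext (x y : background) : (forall z, z ∈ x <-> z ∈ y) -> x = y.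
Proof.
destruct (hset_ofP x) as [[A f] ->], (hset_ofP y) as [[B g] ->]; intro H.
apply hset_of_eq; split.
- intro a; destruct (proj1 (hmem_Sup (hset_of (f a)) g)) as [b Hb].
  + apply H, hmem_Sup; exists a; reflexivity.
  + exists b; apply hset_of_eq, Hb.
- intro b; destruct (proj1 (hmem_Sup (hset_of (g b)) f)) as [a Ha].
  + apply H, hmem_Sup; exists b; reflexivity.
  + exists a; apply hset_of_eq; symmetry; exact Ha.
Qed.

Lemma hset_wf : well_founded (@mem background).
Proof.
intro x; destruct (hset_ofP x) as [t ->]; induction t as [A f IH].
constructor; intros y Hy; apply hmem_Sup in Hy; destruct Hy as [a ->]; apply IH.
Qed.

Lemma hset_replacement (x : background) (S : background -> Prop)
    (F : background -> background) :
  exists y : background, forall z, z ∈ y <-> exists a, a ∈ x /\ S a /\ z = F a.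
Proof.
destruct (hset_ofP x) as [[A f] ->].
destruct (functional_choice _ (fun a => hset_ofP (F (hset_of (f a))))) as [g Hg].
exists (hset_of (Sup (fun a : {a | S (hset_of (f a))} => g (proj1_sig a)))).
intro z; simpl; rewrite hmem_Sup; split.
- intros [[a Sa] ->]; exists (hset_of (f a)); split; [|split; trivial; symmetry; apply Hg].
  apply hmem_Sup; exists a; reflexivity.
- intros (b & Hb & Sb & ->); apply hmem_Sup in Hb; destruct Hb as [a ->].
  exists (exist _ a Sb); apply Hg.
Qed.

Lemma hset_union (x : background) :
  exists y : background, forall z, z ∈ y <-> exists a, a ∈ x /\ z ∈ a.
Proof.
destruct (hset_ofP x) as [[A f] ->].
exists (hset_of (Sup (fun p : {a : A & match f a with @Sup B _ => B end} =>
  match f (projT1 p) as t return match t with @Sup B _ => B end -> tree with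
  | Sup g => g end (projT2 p)))).
intro z; simpl; rewrite hmem_Sup; split.
- intros [[a b] ->]; exists (hset_of (f a)); split.
  + apply hmem_Sup; exists a; reflexivity.
  + simpl in *; destruct (f a) as [B g]; apply hmem_Sup; exists b; reflexivity.
- intros (c & Hc & Hz); apply hmem_Sup in Hc; destruct Hc as [a ->].
  assert (Hb : exists b : match f a with @Sup B _ => B end, z = hset_of
    (match f a as t return match t with @Sup B _ => B end -> tree with
     | Sup g => g end b)).
  { destruct (f a) as [B g]; apply hmem_Sup in Hz; exact Hz. }
  destruct Hb as [b Hb]; exists (existT _ a b); exact Hb.
Qed.

(** * Transitive models *)

Definition transitive_class (V : background -> Prop) : Prop :=
  forall x y, V y -> x ∈ y -> V x.

Definition inner (V : background -> Prop) : eps_struct :=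
  @EpsStruct {x : background | V x} (fun x y => proj1_sig x ∈ proj1_sig y).

(** * Notions of forcing *)

Record forcing (M : eps_struct) := Forcing { cond : M; ord : M; one : M }.

Section Forcing.
Context {M : eps_struct}.
Implicit Types (P Q : forcing M) (p q r i x y : M).

Definition le P q p : Prop := related (ord P) q p.

(** The maximal element is a greatest one, as [1] always is in forcing. *)
Definition is_forcing P : Prop :=
  (forall q p, le P q p -> q ∈ cond P /\ p ∈ cond P) /\
  (forall p, p ∈ cond P -> le P p p) /\
  (forall p q, le P p q -> le P q p -> p = q) /\
  (forall p q r, le P p q -> le P q r -> le P p r) /\
  one P ∈ cond P /\
  (forall p, p ∈ cond P -> le P p (one P)).

Definition compatible P p q : Prop :=
  exists r, r ∈ cond P /\ le P r p /\ le P r q.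

Definition chain_condition P (k : M) : Prop :=
  forall A : M, subset A (cond P) -> card_ge A k ->
    exists p q, p ∈ A /\ q ∈ A /\ p <> q /\ compatible P p q.

Definition is_filter P (G : M -> Prop) : Prop :=
  (forall p, G p -> p ∈ cond P) /\
  (exists p, G p) /\
  (forall p q, G q -> le P q p -> G p) /\
  (forall p q, G p -> G q -> exists r, G r /\ le P r p /\ le P r q).

Definition is_dense P (D : M) : Prop :=
  subset D (cond P) /\
  forall p, p ∈ cond P -> exists d, d ∈ D /\ le P d p.

(** The filter [G] is an arbitrary predicate; only the dense sets are required to
    be elements of [M]. *)
Definition is_generic P (G : M -> Prop) : Prop :=
  is_filter P G /\ forall D, is_dense P D -> exists p, p ∈ D /\ G p.

(** * Product forcing *)

(** A family of forcing notions in [M] indexed by [I] is given by the three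
    functions [i |-> P_i], [i |-> <=_i] and [i |-> 1_i], all elements of [M]. *)
Record family := Family { conds : M; ords : M; ones : M }.

(** [P_i = Q]. *)
Definition factor (F : family) i Q : Prop :=
  related (conds F) i (cond Q) /\ related (ords F) i (ord Q) /\
  related (ones F) i (one Q).

Definition is_family (I : M) (F : family) : Prop :=
  is_function (conds F) I /\ is_function (ords F) I /\ is_function (ones F) I /\
  forall i Q, i ∈ I -> factor F i Q -> is_forcing Q.

Definition is_selection (I : M) (F : family) p : Prop :=
  is_function p I /\
  forall i Q x, i ∈ I -> factor F i Q -> related p i x -> x ∈ cond Q.

Definition in_supp (I : M) (F : family) p i : Prop :=
  i ∈ I /\ exists Q x, factor F i Q /\ related p i x /\ x <> one Q.

Definition finite_supp (I : M) (F : family) p : Prop :=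
  exists s : M, (forall i, i ∈ s <-> in_supp I F p i) /\ is_finite s.

(** [m] is the function [i |-> min {p(i), q(i)}]. *)
Definition is_pointwise_min (I : M) (F : family) (m p q : M) : Prop :=
  is_function m I /\
  forall i Q x y z, i ∈ I -> factor F i Q ->
    related p i x -> related q i y -> related m i z ->
    (z = x \/ z = y) /\ le Q z x /\ le Q z y.

(** [r] is [p] restricted to [J], in the sense that [r] is [1] off [J]. *)
Definition is_restriction (I : M) (F : family) (r p J : M) : Prop :=
  is_function r I /\
  (forall i x, i ∈ I -> i ∈ J -> related p i x -> related r i x) /\
  (forall i Q, i ∈ I -> ~ i ∈ J -> factor F i Q -> related r i (one Q)).

Record product_forcing (I : M) (F : family) P : Prop := {
  prod_family : is_family I F;
  prod_forcing : is_forcing P;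
  prod_selection : forall p, p ∈ cond P -> is_selection I F p;
  prod_finite : forall p, is_selection I F p -> finite_supp I F p -> p ∈ cond P;
  prod_le : forall q p, q ∈ cond P -> p ∈ cond P ->
    (le P q p <-> forall i Q y x, i ∈ I -> factor F i Q ->
                    related q i y -> related p i x -> le Q y x);
  prod_min : forall p q, p ∈ cond P -> q ∈ cond P ->
    (forall i, ~ (in_supp I F p i /\ in_supp I F q i)) ->
    exists m, is_pointwise_min I F m p q /\ m ∈ cond P;
  prod_restriction : forall p J, p ∈ cond P -> subset J I ->
    exists r, is_restriction I F r p J /\ r ∈ cond P
}.

Definition bounded_support (g : M) (F : family) P : Prop :=
  forall p, p ∈ cond P -> exists d : M, d ∈ g /\ is_restriction g F p p d.

(** [X|J = {p|J : p ∈ X}], used both for the forcing and for the generic filter. *)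
Definition restrict (I : M) (F : family) (X : M -> Prop) (J : M) : M -> Prop :=
  fun r => exists p, X p /\ is_restriction I F r p J.

End Forcing.
Arguments family : clear implicits.

(** * Generic extensions *)

Inductive is_name (M : eps_struct) (P : M -> Prop) : M -> Prop :=
| IsName (t : M) :
    (forall z, z ∈ t -> exists s p, is_opair z s p /\ P p) ->
    (forall s p, related t s p -> is_name P s) ->
    is_name P t.

(** [is_value G t x] says that [x = t_G], where
    [t_G = {s_G : (s, p) ∈ t for some p ∈ G}]; [v] lists the values of the [s]. *)
Inductive is_value (M : eps_struct) (G : M -> Prop) : M -> background -> Prop :=
| IsValue (t : M) (v : M -> background) (x : background) :
    (forall s p, G p -> related t s p -> is_value G s (v s)) ->
    (forall y, y ∈ x <-> exists s p, G p /\ related t s p /\ y = v s) ->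
    is_value G t x.

Lemma is_value_unique (M : eps_struct) (G : M -> Prop) t x y :
  is_value G t x -> is_value G t y -> x = y.
Proof.
intro H; revert y; induction H as [t v x Hv IH Hx]; intros y H'.
inversion H' as [t' w y' Hw Hy]; subst.
apply hset_ext; intro z; rewrite Hx, Hy.
split; intros (s & p & Gp & Hs & ->); exists s, p; repeat split; trivial.
- exact (IH s p Gp Hs _ (Hw s p Gp Hs)).
- symmetry; exact (IH s p Gp Hs _ (Hw s p Gp Hs)).
Qed.

Lemma inner_wf (V : background -> Prop) : well_founded (@mem (inner V)).
Proof. exact (wf_inverse_image _ _ _ (@proj1_sig _ _) hset_wf). Qed.

Lemma is_value_exists (V : background -> Prop) (V_ZFC : ZFC (inner V))
    (G : inner V -> Prop) (t : inner V) : exists x, is_value G t x.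
Proof.
revert t; apply (well_founded_ind (wf_clos_trans _ _ (@inner_wf V))).
intros t IH.
pose (sub := fun s : inner V => exists p, G p /\ related t s p).
assert (D : forall s, sub s -> exists c z : inner V, s ∈ c /\ c ∈ z /\ z ∈ t).
{ intros s (p & Gp & z & Hz & zt).
  destruct (zfc_pairing V_ZFC s s) as [c Hc]; exists c, z; repeat split; trivial.
  - apply Hc; left; reflexivity.
  - apply Hz; left; exact Hc. }
assert (H : forall b : background, exists x, forall s : inner V,
  proj1_sig s = b -> sub s -> is_value G s x).
{ intro b; destruct (classic (exists s : inner V, proj1_sig s = b /\ sub s))
    as [(s & <- & Hs)|N].
  - destruct (D s Hs) as (c & z & sc & cz & zt).
    destruct (IH s) as [x Hx].
    + eapply Relation_Operators.t_trans; [apply Relation_Operators.t_step, sc|].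
      eapply Relation_Operators.t_trans; apply Relation_Operators.t_step;
        [exact cz|exact zt].
    + exists x; intros s' E _; replace s' with s; trivial.
      destruct s, s'; simpl in E; subst; f_equal; apply proof_irrelevance.
  - exists b; intros s E Hs; exfalso; apply N; exists s; split; assumption. }
destruct (functional_choice _ H) as [w Hw].
destruct (hset_union (proj1_sig t)) as [u Hu], (hset_union u) as [u' Hu'].
destruct (hset_replacement u'
  (fun b => exists s : inner V, proj1_sig s = b /\ sub s) w) as [x Hx].
exists x; apply IsValue with (fun s => w (proj1_sig s)).
- intros s p Gp Hs; apply Hw; trivial; exists p; split; assumption.
- intro y; rewrite Hx; split.
  + intros (b & _ & (s & <- & p & Gp & Hs) & ->); exists s, p; repeat split; trivial.
  + intros (s & p & Gp & Hs & ->); exists (proj1_sig s).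
    assert (S : sub s) by (exists p; split; assumption).
    split; [|split; [exists s; split; trivial|reflexivity]].
    destruct (D s S) as (c & z & sc & cz & zt).
    apply Hu'; exists (proj1_sig c); split; [apply Hu|exact sc].
    exists (proj1_sig z); split; [exact zt|exact cz].
Qed.

(** The extension [V[G]] for a filter [G] on the forcing with conditions [P]. *)
Definition extension (V : background -> Prop) (P G : inner V -> Prop) :
    background -> Prop :=
  fun x => exists t : inner V, is_name P t /\ is_value G t x.

(** The functions from [n] to [V] that belong to [W]. *)
Definition functions_in (V W : background -> Prop) (n f : background) : Prop :=
  W f /\ is_function f n /\ forall a b, related f a b -> V b.

Definition is_final (V : background -> Prop) (g : inner V)
    (F : family (inner V)) (P : forcing (inner V)) (k : inner V) : Prop :=
  forall G : inner V -> Prop, is_generic P G ->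
  forall n : inner V, n ∈ k ->
  forall f : background,
    functions_in V (extension (fun p => p ∈ cond P) G) (proj1_sig n) f <->
    exists a : inner V, a ∈ g /\
      functions_in V
        (extension (restrict g F (fun p => p ∈ cond P) a) (restrict g F G a))
        (proj1_sig n) f.

(* Main.v *)
From Stdlib Require Import Classical IndefiniteDescription Wellfounded.
From Stdlib Require Import Relation_Operators Arith.
Require Import Defs.

Set Implicit Arguments.
Unset Strict Implicit.
Unset Printing Implicit Defensive.

(** Let [f : n -> V] in [V[G]] have the name [t], with [n < cf gamma]. Since [f]
    is contained in [V], only the statement that a condition forces a name to
    equal a ground model set is needed; it is definable in [V], and below [G] it
    is true exactly when it is forced. For each [x < n] there is [d_x < gamma]
    such that every condition deciding [f(x)] is compatible with one that is
    supported in [d_x]: otherwise one chooses, by recursion of length [cf gamma],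
    conditions incompatible with all the previous ones, whose supports stay
    bounded, against the chain condition. Then [d = sup d_x < gamma], every value
    of [f] is decided by a member of [G] supported in [d], and the pairs of a
    check name and such a condition form a name of [f] over [G|d]. *)

(** * Definability with parameters *)

(** Two features of the setting shape the proof. The model satisfies separation and replacement for
    first-order formulas only, and [G] is a predicate outside it; so each set built in the ground
    model, from dense sets to the antichain, comes with a proof of definability from parameters, and
    selections inside a recursion are made canonical by a well-ordering or by leastness. Names need
    only be compared with ground model sets because each element of [f] is an ordered pair of
    elements of [V], hence itself in [V]; this avoids a simultaneous recursion on two names. That
    fewer than [cf gamma] ordinals below [gamma] have a bound below [gamma] enters twice: along the
    recursion, where the earlier supports must leave room, and over [n]. Compatibility with a
    bounded condition is enough because genericity then puts some bounded deciding condition into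
    [G], and what it decides is the true value. *)

Fixpoint rename (r : nat -> nat) (A : formula) : formula :=
  match A with
  | fMem i j => fMem (r i) (r j)
  | fEq i j => fEq (r i) (r j)
  | fNot A => fNot (rename r A)
  | fAnd A B => fAnd (rename r A) (rename r B)
  | fEx A => fEx (rename (fun n => match n with 0 => 0 | S m => S (r m) end) A)
  end.

Lemma sat_rename (M : eps_struct) (A : formula) (r : nat -> nat) (e e' : nat -> M) :
  (forall n, e' (r n) = e n) -> (sat e' (rename r A) <-> sat e A).
Proof.
revert r e e'; induction A as [i j|i j|A IH|A IHA B IHB|A IH]; simpl; intros r e e' H.
- rewrite !H; tauto.
- rewrite !H; tauto.
- rewrite (IH _ _ _ H); tauto.
- rewrite (IHA _ _ _ H), (IHB _ _ _ H); tauto.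
- assert (K : forall x n, scons x e' (match n with 0 => 0 | S m => S (r m) end)
      = scons x e n) by (intros x [|n]; simpl; auto).
  split; intros [x Hx]; exists x; apply (IH _ _ _ (K x)); exact Hx.
Qed.

Section Definability.
Context {M : eps_struct}.
Implicit Types (Q : (nat -> M) -> Prop) (t : (nat -> M) -> M) (e : nat -> M).

Definition assign (v : nat -> nat + M) e : nat -> M :=
  fun n => match v n with inl i => e i | inr m => m end.

(** The variables of the formula are sent by [v] either to variables of the
    predicate or to parameters from [M]. *)
Definition definable Q : Prop :=
  exists (A : formula) (v : nat -> nat + M), forall e, Q e <-> sat (assign v e) A.

(** The graph is used, with the value in variable 0 and the arguments shifted by one, since the
    language has no function symbols. *)
Definition definable_term t : Prop :=
  definable (fun e => e 0 = t (fun n => e (S n))).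

Lemma definable_ext Q Q' :
  (forall e, Q' e <-> Q e) -> definable Q -> definable Q'.
Proof.
intros H (A & v & HA); exists A, v; intro e; rewrite H; apply HA.
Qed.

Lemma definable_mem_var i j : definable (fun e => e i ∈ e j).
Proof. exists (fMem i j), inl; intro e; reflexivity. Qed.

Lemma definable_eq_var i j : definable (fun e => e i = e j).
Proof. exists (fEq i j), inl; intro e; reflexivity. Qed.

Lemma definable_const (m : M) : definable_term (fun _ => m).
Proof.
exists (fEq 0 1), (fun n => match n with 0 => inl 0 | _ => inr m end).
intro e; reflexivity.
Qed.

Lemma definable_var i : definable_term (fun e => e i).
Proof. apply definable_eq_var. Qed.

Lemma definable_not Q : definable Q -> definable (fun e => ~ Q e).
Proof.
intros (A & v & HA); exists (fNot A), v; intro e; simpl; rewrite HA; reflexivity.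
Qed.

(** The two formulas come with different parameter maps. Moving the indices of one to even and of
    the other to odd numbers lets a single map serve both. *)
Lemma definable_and Q Q' :
  definable Q -> definable Q' -> definable (fun e => Q e /\ Q' e).
Proof.
intros (A & v & HA) (B & w & HB).
exists (fAnd (rename (fun n => 2 * n) A) (rename (fun n => S (2 * n)) B)).
exists (fun n => if Nat.even n then v (Nat.div2 n) else w (Nat.div2 n)).
intro e; cbn [sat]; rewrite HA, HB.
rewrite (@sat_rename M A _ (assign v e)), (@sat_rename M B _ (assign w e));
  [reflexivity| |]; intro n; unfold assign.
- rewrite Nat.even_succ, <- Nat.negb_even, Nat.even_even, Nat.div2_succ_double.
  reflexivity.
- rewrite Nat.even_even, Nat.div2_double; reflexivity.
Qed.

Lemma definable_rename (r : nat -> nat) Q :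
  definable Q -> definable (fun e => Q (fun n => e (r n))).
Proof.
intros (A & v & HA).
exists (rename (fun n => n) A).
exists (fun n => match v n with inl i => inl (r i) | inr m => inr m end).
intro e; rewrite HA; symmetry; apply sat_rename.
intro n; unfold assign; destruct (v n); reflexivity.
Qed.

Lemma definable_ex (B : M -> (nat -> M) -> Prop) :
  definable (fun e => B (e 0) (fun n => e (S n))) ->
  definable (fun e => exists x, B x e).
Proof.
intros (A & v & HA).
(* Several indices may be sent to variable 0 by [v]; all of them become the bound index, and the
   others move up by one under the quantifier. *)
exists (fEx (rename (fun n => match v n with inl 0 => 0 | _ => S n end) A)).
exists (fun n => match v n with inl (S i) => inl i | k => k end).
intro e; cbn [sat].
assert (K : forall x, B x e <-> sat (assign v (scons x e)) A).
{ intro x; rewrite <- HA; reflexivity. }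
split; intros [x Hx]; exists x; revert Hx; rewrite K;
  rewrite (@sat_rename M A _ (assign v (scons x e))); trivial;
  intro n; unfold assign, scons; destruct (v n) as [[|i]|m] eqn:E; rewrite ?E; trivial.
Qed.

Lemma definable_or Q Q' :
  definable Q -> definable Q' -> definable (fun e => Q e \/ Q' e).
Proof.
intros H H'; apply definable_ext with (fun e => ~ (~ Q e /\ ~ Q' e));
  [intro e; tauto|].
apply definable_not, definable_and; apply definable_not; assumption.
Qed.

Lemma definable_imp Q Q' :
  definable Q -> definable Q' -> definable (fun e => Q e -> Q' e).
Proof.
intros H H'; apply definable_ext with (fun e => ~ (Q e /\ ~ Q' e));
  [intro e; tauto|].
apply definable_not, definable_and; [|apply definable_not]; assumption.
Qed.

Lemma definable_iff Q Q' :
  definable Q -> definable Q' -> definable (fun e => Q e <-> Q' e).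
Proof. intros; apply definable_and; apply definable_imp; assumption. Qed.

Lemma definable_all (B : M -> (nat -> M) -> Prop) :
  definable (fun e => B (e 0) (fun n => e (S n))) ->
  definable (fun e => forall x, B x e).
Proof.
intro H; apply definable_ext with (fun e => ~ exists x, ~ B x e).
- intro e; split; [firstorder|]; intros K x; apply NNPP; intro N; apply K.
  exists x; exact N.
- apply definable_not, definable_ex with (B := fun x e => ~ B x e).
  apply definable_not, H.
Qed.

(** Restrictions in a product quantify over factors, which are records; such a quantifier unfolds
    into three quantifiers over sets, the last field being innermost. *)
Lemma definable_all_forcing (B : forcing M -> (nat -> M) -> Prop) :
  definable (fun e => B (Forcing (e 2) (e 1) (e 0)) (fun n => e (S (S (S n))))) ->
  definable (fun e => forall Q : forcing M, B Q e).
Proof.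
intro H; apply definable_ext with (fun e => forall c o u, B (Forcing c o u) e).
- intro e; split; auto; intros K [c o u]; apply K.
- apply definable_all with (B := fun c e => forall o u, B (Forcing c o u) e).
  apply definable_all
    with (B := fun o e => forall u, B (Forcing (e 0) o u) (fun n => e (S n))).
  apply definable_all
    with (B := fun u e => B (Forcing (e 1) (e 0) u) (fun n => e (S (S n)))).
  exact H.
Qed.

Lemma definable_let t (B : M -> (nat -> M) -> Prop) :
  definable_term t -> definable (fun e => B (e 0) (fun n => e (S n))) ->
  definable (fun e => B (t e) e).
Proof.
intros Ht HB; apply definable_ext with (fun e => exists x, x = t e /\ B x e).
- intro e; split; [intro H; exists (t e); auto|intros (x & -> & H); exact H].
- apply definable_ex with (B := fun x e => x = t e /\ B x e).
  apply definable_and; assumption.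
Qed.

Lemma definable_rename_term (r : nat -> nat) t :
  definable_term t -> definable_term (fun e => t (fun n => e (r n))).
Proof.
exact (@definable_rename (fun n => match n with 0 => 0 | S m => S (r m) end)
  (fun e => e 0 = t (fun n => e (S n)))).
Qed.

Lemma definable_rel1 (R : M -> Prop) t :
  definable (fun e => R (e 0)) -> definable_term t -> definable (fun e => R (t e)).
Proof. intros H Ht; apply (definable_let (B := fun x _ => R x)); assumption. Qed.

Lemma definable_rel2 (R : M -> M -> Prop) t t' :
  definable (fun e => R (e 0) (e 1)) ->
  definable_term t -> definable_term t' -> definable (fun e => R (t e) (t' e)).
Proof.
intros H Ht Ht'; apply (definable_let (B := fun x e => R x (t' e)) Ht).
apply (definable_let (t := fun e => t' (fun n => e (S n))) (B := fun y e => R (e 0) y)).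
- apply definable_rename_term with (r := S), Ht'.
- exact (definable_rename (fun n => match n with 0 => 1 | _ => 0 end) H).
Qed.

Lemma definable_rel3 (R : M -> M -> M -> Prop) t t' t'' :
  definable (fun e => R (e 0) (e 1) (e 2)) ->
  definable_term t -> definable_term t' -> definable_term t'' ->
  definable (fun e => R (t e) (t' e) (t'' e)).
Proof.
intros H Ht Ht' Ht''; apply (definable_let (B := fun x e => R x (t' e) (t'' e)) Ht).
apply (definable_let (t := fun e => t' (fun n => e (S n)))
  (B := fun y e => R (e 0) y (t'' (fun n => e (S n))))).
- apply definable_rename_term with (r := S), Ht'.
- apply (definable_let (t := fun e => t'' (fun n => e (S (S n))))
    (B := fun z e => R (e 1) (e 0) z)).
  + apply definable_rename_term with (r := fun n => S (S n)), Ht''.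
  + exact (definable_rename (fun n => match n with 0 => 2 | 1 => 1 | _ => 0 end) H).
Qed.

Lemma definable_mem t t' :
  definable_term t -> definable_term t' -> definable (fun e => t e ∈ t' e).
Proof. apply definable_rel2, definable_mem_var. Qed.

Lemma definable_eq t t' :
  definable_term t -> definable_term t' -> definable (fun e => t e = t' e).
Proof. apply (definable_rel2 (R := eq)), definable_eq_var. Qed.

End Definability.

Create HintDb definable.
Ltac definable := cbn beta; typeclasses eauto with definable nocore.
#[export] Hint Resolve definable_const definable_var definable_not definable_and
  definable_or definable_imp definable_iff definable_ex definable_all
  definable_all_forcing definable_mem definable_eq : definable.

Lemma definable_subset (M : eps_struct) (t t' : (nat -> M) -> M) :
  definable_term t -> definable_term t' -> definable (fun e => subset (t e) (t' e)).
Proof. apply definable_rel2; unfold subset; definable. Qed.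

Lemma definable_upair (M : eps_struct) (t t' t'' : (nat -> M) -> M) :
  definable_term t -> definable_term t' -> definable_term t'' ->
  definable (fun e => is_upair (t e) (t' e) (t'' e)).
Proof. apply definable_rel3; unfold is_upair; definable. Qed.
#[export] Hint Resolve definable_subset definable_upair : definable.

Lemma definable_opair (M : eps_struct) (t t' t'' : (nat -> M) -> M) :
  definable_term t -> definable_term t' -> definable_term t'' ->
  definable (fun e => is_opair (t e) (t' e) (t'' e)).
Proof. apply definable_rel3; unfold is_opair; definable. Qed.
#[export] Hint Resolve definable_opair : definable.

Lemma definable_related (M : eps_struct) (t t' t'' : (nat -> M) -> M) :
  definable_term t -> definable_term t' -> definable_term t'' ->
  definable (fun e => related (t e) (t' e) (t'' e)).
Proof. apply definable_rel3; unfold related; definable. Qed.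
#[export] Hint Resolve definable_related : definable.

(** * Set theory inside a well-founded model of ZFC *)

Section SetTheory.
Context {M : eps_struct} (M_ZFC : ZFC M) (M_wf : well_founded (@mem M)).
Implicit Types a b c d f h r s t w x y z : M.

Lemma separation (Q : M -> Prop) a :
  definable (fun e => Q (e 0)) -> exists b, forall x, x ∈ b <-> x ∈ a /\ Q x.
Proof.
intros (A & v & HA).
(* At the constant assignment [x], each index that [v] sends to a variable denotes [x] and can be
   renamed to 0; parameter indices are shifted past it. *)
destruct (zfc_separation M_ZFC
  (rename (fun n => match v n with inl _ => 0 | inr _ => S n end) A)
  (fun n => match v n with inl _ => a | inr m => m end) a) as [b Hb].
exists b; intro x; rewrite Hb, (HA (fun _ => x)).
rewrite (@sat_rename M A _ (assign v (fun _ => x))); [reflexivity|].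
intro n; unfold assign, scons; destruct (v n) eqn:E; rewrite ?E; reflexivity.
Qed.

(** The axiom asks for a total function and yields only a set containing its values. Cutting [a]
    down to the domain of [R] supplies totality, and separation leaves exactly the image. *)
Lemma replacement (R : M -> M -> Prop) a :
  definable (fun e => R (e 0) (e 1)) ->
  (forall x y y', x ∈ a -> R x y -> R x y' -> y = y') ->
  exists b, forall y, y ∈ b <-> exists x, x ∈ a /\ R x y.
Proof.
intros D U.
destruct (separation (Q := fun x => exists y, R x y) a) as [a' Ha'].
{ apply definable_ex with (B := fun y e => R (e 0) y).
  exact (definable_rename (fun n => match n with 0 => 1 | _ => 0 end) D). }
pose proof D as (A & v & HA).
assert (K : forall m x y, sat (scons x (scons y
    (fun n => match v n with inl _ => m | inr m => m end)))
    (rename (fun n => match v n with inl 0 => 0 | inl _ => 1 | inr _ => S (S n) end) A)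
    <-> R x y).
{ intros m x y; rewrite (HA (fun n => match n with 0 => x | _ => y end)).
  apply sat_rename; intro n; unfold assign, scons.
  destruct (v n) as [[|i]|] eqn:E; rewrite ?E; reflexivity. }
destruct (zfc_replacement M_ZFC
  (A := rename (fun n => match v n with inl 0 => 0 | inl _ => 1 | inr _ => S (S n) end) A)
  (e := fun n => match v n with inl _ => a | inr m => m end) (a := a')) as [b Hb].
{ intros x Hx; apply Ha' in Hx; destruct Hx as [Hx [y Hy]]; exists y; split.
  - apply K, Hy.
  - intros y' Hy'; apply K in Hy'; eauto. }
destruct (separation (Q := fun y => exists x, x ∈ a /\ R x y) b) as [c Hc].
{ apply definable_ex with (B := fun x e => x ∈ a /\ R x (e 0)).
  apply definable_and; [definable|exact D]. }
exists c; intro y; rewrite Hc; split; [tauto|]; intros (x & Hx & Hy).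
split; [|eauto].
destruct (Hb x) as (y' & Hy' & Hs); [apply Ha'; eauto|].
apply K in Hs; rewrite (U x y y'); auto.
Qed.

Lemma union2 a b : exists c, forall z, z ∈ c <-> z ∈ a \/ z ∈ b.
Proof.
destruct (zfc_pairing M_ZFC a b) as [p Hp], (zfc_union M_ZFC p) as [c Hc].
exists c; intro z; rewrite Hc; split.
- intros (y & Hy & Hz); apply Hp in Hy; destruct Hy as [->| ->]; auto.
- intros [H|H]; [exists a|exists b]; split; trivial; apply Hp; auto.
Qed.

Lemma upair_unique c c' a b : is_upair c a b -> is_upair c' a b -> c = c'.
Proof.
intros H H'; apply (zfc_extensionality M_ZFC); intro z; rewrite (H z), (H' z); tauto.
Qed.

Lemma upair_inj c a b b' : is_upair c a b -> is_upair c a b' -> b = b'.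
Proof.
intros H H'.
destruct (proj1 (H' b) (proj2 (H b) (or_intror eq_refl))) as [->|]; trivial.
destruct (proj1 (H b') (proj2 (H' b') (or_intror eq_refl))); auto.
Qed.

Lemma upair_diag c a b b' : is_upair c a a -> is_upair c b b' -> b = a.
Proof.
intros H H'; destruct (proj1 (H b) (proj2 (H' b) (or_introl eq_refl))); trivial.
Qed.

Lemma opair_exists a b : exists z, is_opair z a b.
Proof.
destruct (zfc_pairing M_ZFC a a) as [c Hc], (zfc_pairing M_ZFC a b) as [d Hd].
destruct (zfc_pairing M_ZFC c d) as [z Hz]; exists z; intro y; rewrite (Hz y); split.
- intros [->| ->]; auto.
- intros [H|H]; [left|right]; eapply upair_unique; eauto.
Qed.

Lemma opair_unique z z' a b : is_opair z a b -> is_opair z' a b -> z = z'.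
Proof.
intros H H'; apply (zfc_extensionality M_ZFC); intro y; rewrite (H y), (H' y); tauto.
Qed.

Lemma opair_inj z a b a' b' : is_opair z a b -> is_opair z a' b' -> a = a' /\ b = b'.
Proof.
intros H H'.
destruct (zfc_pairing M_ZFC a a) as [c Hc], (zfc_pairing M_ZFC a b) as [d Hd].
destruct (zfc_pairing M_ZFC a' b') as [d' Hd'].
assert (E : a = a').
{ destruct (proj1 (H' c) (proj2 (H c) (or_introl Hc))) as [K|K];
    symmetry; eapply upair_diag; eauto. }
subst a'; split; trivial.
destruct (proj1 (H' d) (proj2 (H d) (or_intror Hd))) as [K|K];
  [|eapply upair_inj; eauto].
destruct (proj1 (H d') (proj2 (H' d') (or_intror Hd'))) as [K'|K'];
  [|symmetry; eapply upair_inj; eauto].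
transitivity a.
- destruct (proj1 (K b) (proj2 (Hd b) (or_intror eq_refl))); auto.
- destruct (proj1 (K' b') (proj2 (Hd' b') (or_intror eq_refl))); auto.
Qed.

Lemma related_opair r z a b : is_opair z a b -> (related r a b <-> z ∈ r).
Proof.
intro H; split.
- intros (z' & H' & Hz); rewrite (opair_unique H H'); exact Hz.
- intro Hz; exists z; auto.
Qed.

Lemma pairs_bounded a b : exists c, forall z x y,
  is_opair z x y -> x ∈ a -> y ∈ b -> z ∈ c.
Proof.
destruct (union2 a b) as [u Hu], (zfc_power M_ZFC u) as [p Hp], (zfc_power M_ZFC p) as [c Hc].
exists c; intros z x y Hz Hx Hy; apply Hc; intros w Hw; apply Hp; intros v Hv; apply Hu.
apply Hz in Hw; destruct Hw as [Hw|Hw]; apply Hw in Hv;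
  destruct Hv as [->| ->]; auto.
Qed.

Lemma relation_set (R : M -> M -> Prop) a b :
  definable (fun e => R (e 0) (e 1)) ->
  exists r, (forall z, z ∈ r -> exists x y, is_opair z x y /\ x ∈ a /\ y ∈ b /\ R x y) /\
    forall x y, related r x y <-> x ∈ a /\ y ∈ b /\ R x y.
Proof.
intro D; destruct (pairs_bounded a b) as [c Hc].
destruct (separation (Q := fun z => exists x y, is_opair z x y /\ x ∈ a /\ y ∈ b /\ R x y) c)
  as [r Hr].
{ apply definable_ex with
    (B := fun x e => exists y, is_opair (e 0) x y /\ x ∈ a /\ y ∈ b /\ R x y).
  apply definable_ex with
    (B := fun y e => is_opair (e 1) (e 0) y /\ e 0 ∈ a /\ y ∈ b /\ R (e 0) y).
  repeat (apply definable_and; [definable|]).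
  exact (definable_rename (fun n => match n with 0 => 1 | _ => 0 end) D). }
exists r; split; [intros z Hz; apply Hr, Hz|]; intros x y; split.
- intros (z & Hz & zr); apply Hr in zr; destruct zr as (_ & x' & y' & Hz' & K).
  destruct (opair_inj Hz Hz') as [-> ->]; exact K.
- intros (Hx & Hy & H); destruct (opair_exists x y) as [z Hz]; exists z; split; trivial.
  apply Hr; split; [eauto|exists x, y; auto].
Qed.

Lemma function_set (R : M -> M -> Prop) d :
  definable (fun e => R (e 0) (e 1)) ->
  (forall x, x ∈ d -> exists! y, R x y) ->
  exists f, is_function f d /\ forall x y, related f x y <-> x ∈ d /\ R x y.
Proof.
intros D H.
destruct (replacement (R := R) (a := d) D) as [c Hc].
{ intros x y y' Hx K K'; destruct (H x Hx) as (w & _ & U).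
  rewrite <- (U y K); auto. }
destruct (relation_set d c D) as (f & Hf & Hr); exists f.
assert (E : forall x y, related f x y <-> x ∈ d /\ R x y).
{ intros x y; rewrite Hr; split; [tauto|]; intros [Hx K]; repeat split; trivial.
  apply Hc; eauto. }
split; [split|]; trivial.
- intros z Hz; destruct (Hf z Hz) as (x & y & K & Hx & _); eauto.
- intros x Hx; destruct (H x Hx) as (y & K & U); exists y; split.
  + apply E; auto.
  + intros y' Hy'; apply U, E, Hy'.
Qed.

Lemma related_insert r x y : exists r', forall a b,
  related r' a b <-> related r a b \/ (a = x /\ b = y).
Proof.
destruct (opair_exists x y) as [z Hz], (zfc_pairing M_ZFC z z) as [s Hs].
destruct (union2 r s) as [r' Hr']; exists r'; intros a b.
destruct (opair_exists a b) as [w Hw]; rewrite !(related_opair _ Hw), (Hr' w), (Hs w).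
split; intros [H|H]; auto; right.
- assert (w = z) as -> by tauto; apply (opair_inj Hw Hz).
- destruct H as [-> ->]; left; exact (opair_unique Hw Hz).
Qed.

Lemma mem_irrefl x : ~ x ∈ x.
Proof. induction (M_wf x) as [x _ IH]; intro H; exact (IH x H H). Qed.

Lemma mem_asym x y : x ∈ y -> ~ y ∈ x.
Proof.
revert y; induction (M_wf x) as [x _ IH]; intros y H H'; exact (IH y H' x H' H).
Qed.

Lemma below_wf : well_founded (clos_trans M (@mem M)).
Proof. apply wf_clos_trans, M_wf. Qed.

(** The chain is [s ∈ {s} ∈ (s, p) ∈ r]; it is what lets induction along [below_wf] run over
    names. *)
Lemma related_below r s p : related r s p -> clos_trans M (@mem M) s r.
Proof.
intros (z & Hz & zr); destruct (zfc_pairing M_ZFC s s) as [c Hc].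
apply t_trans with z; [|apply t_step, zr].
apply t_trans with c; apply t_step; [apply Hc|apply Hz]; auto.
Qed.

Lemma transitive_related a r s p :
  is_transitive a -> r ∈ a -> related r s p -> s ∈ a.
Proof.
intros T Hr (z & Hz & zr); destruct (zfc_pairing M_ZFC s s) as [c Hc].
apply (T c); [apply (T z); [apply (T r Hr), zr|apply Hz; auto]|apply Hc; auto].
Qed.

(** Minimality makes the transitive closure unique, so that replacement can collect the closures of
    the members of a set. *)
Definition is_closure (t x : M) : Prop :=
  is_transitive t /\ subset x t /\
  forall s, is_transitive s -> subset x s -> subset t s.

(** By membership induction: the closure is [x] together with the closures of its members. The
    second conjunct ties this set of the model to the external relation used for induction. *)
Lemma closure_exists x : exists t, is_closure t x /\
  forall y, y ∈ t -> clos_trans M (@mem M) y x.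
Proof.
induction (M_wf x) as [x _ IH].
destruct (replacement (R := fun y t => is_closure t y) (a := x)) as [c Hc].
{ unfold is_closure, is_transitive; definable. }
{ intros y t t' _ (T & S & L) (T' & S' & L').
  apply (zfc_extensionality M_ZFC); intro z; split; [apply L|apply L']; trivial. }
destruct (zfc_union M_ZFC c) as [u Hu], (union2 x u) as [t Ht].
assert (I : forall y, y ∈ x -> exists s, is_closure s y /\ subset s t /\
    forall z, z ∈ s -> clos_trans M (@mem M) z y).
{ intros y Hy; destruct (IH y Hy) as (s & Hs & B); exists s; split; [trivial|split; [|trivial]].
  intros z Hz; apply Ht; right; apply Hu; exists s; split; trivial.
  apply Hc; eauto. }
exists t; split; [repeat split|].
- intros y Hy z Hz; apply Ht in Hy; destruct Hy as [Hy|Hy].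
  + destruct (I y Hy) as (s & (_ & K & _) & B & _); apply B, K, Hz.
  + apply Hu in Hy; destruct Hy as (s & Hs & Hy); apply Ht; right; apply Hu.
    exists s; split; trivial.
    apply Hc in Hs; destruct Hs as (w & _ & T & _); exact (T y Hy z Hz).
- intros y Hy; apply Ht; auto.
- intros s T S y Hy; apply Ht in Hy; destruct Hy as [Hy|Hy]; [auto|].
  apply Hu in Hy; destruct Hy as (s' & Hs' & Hy).
  apply Hc in Hs'; destruct Hs' as (w & Hw & _ & _ & L).
  apply (L s); trivial; apply T, S, Hw.
- intros y Hy; apply Ht in Hy; destruct Hy as [Hy|Hy]; [apply t_step, Hy|].
  apply Hu in Hy; destruct Hy as (s' & Hs' & Hy).
  apply Hc in Hs'; destruct Hs' as (w & Hw & _ & _ & L).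
  destruct (I w Hw) as (s & (T & S & _) & _ & B).
  apply t_trans with w; [|apply t_step, Hw]; apply B.
  exact (L s T S y Hy).
Qed.

(** * Recursion along membership *)

Section Recursion.
Context (W : M -> M -> Prop) (W_definable : definable (fun e => W (e 0) (e 1))).
Context (W_set : forall s, exists c, forall w, w ∈ c <-> W s w).

Let definable_W (t t' : (nat -> M) -> M) : definable_term t -> definable_term t' ->
  definable (fun e => W (t e) (t' e)).
Proof. apply definable_rel2, W_definable. Qed.
#[local] Hint Resolve definable_W : definable.

Definition recursive_at h x y : Prop :=
  (forall z, z ∈ x -> exists s, related h z s) /\
  forall w, w ∈ y <-> exists z s, z ∈ x /\ related h z s /\ W s w.

(** The approximation [h] has only to obey the recursion equation at its own pairs; that it is
    single-valued, and that approximations agree, follows by induction. *)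
Definition recursion_value x y : Prop :=
  exists h, related h x y /\ forall a b, related h a b -> recursive_at h a b.

Lemma definable_recursion_value (t t' : (nat -> M) -> M) :
  definable_term t -> definable_term t' ->
  definable (fun e => recursion_value (t e) (t' e)).
Proof.
apply definable_rel2; unfold recursion_value, recursive_at; definable.
Qed.
#[local] Hint Resolve definable_recursion_value : definable.

Lemma recursion_value_unique x y y' :
  recursion_value x y -> recursion_value x y' -> y = y'.
Proof.
intros (h & H & Hh) (h' & H' & Hh'); revert y y' H H'.
induction (M_wf x) as [x _ IH]; intros y y' H H'.
destruct (Hh _ _ H) as [T E], (Hh' _ _ H') as [T' E'].
apply (zfc_extensionality M_ZFC); intro w; rewrite (E w), (E' w).
split; intros (z & s & Hz & Hs & Hw).
- destruct (T' z Hz) as [s' Hs']; exists z, s'; repeat split; trivial.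
  rewrite <- (IH z Hz s s'); trivial.
- destruct (T z Hz) as [s' Hs']; exists z, s'; repeat split; trivial.
  rewrite (IH z Hz s' s); trivial.
Qed.

Lemma recursion_value_exists x : exists y, recursion_value x y.
Proof.
induction (below_wf x) as [x _ IH].
(* The values on the whole transitive closure are gathered into one approximation [h], to which the
   pair [(x, y)] is added afterwards. *)
destruct (closure_exists x) as (t & (T & S & _) & B).
destruct (function_set (R := recursion_value) (d := t)) as (h & _ & Hh); [definable| |].
{ intros z Hz; destruct (IH z (B z Hz)) as [s Hs]; exists s; split; trivial.
  intros s'; apply recursion_value_unique, Hs. }
destruct (replacement
  (R := fun z c => exists s, related h z s /\ forall w, w ∈ c <-> W s w) (a := x))
  as [c Hc]; [definable| |].
{ intros z d d' _ (s & Hs & Hd) (s' & Hs' & Hd').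
  apply Hh in Hs, Hs'; rewrite (recursion_value_unique (proj2 Hs') (proj2 Hs)) in Hd'.
  apply (zfc_extensionality M_ZFC); intro w; rewrite Hd, Hd'; tauto. }
destruct (zfc_union M_ZFC c) as [y Hy]; exists y.
destruct (related_insert h x y) as [h' Hh'].
exists h'; split; [apply Hh'; auto|]; intros a b Hab.
assert (V : forall z, z ∈ t -> exists s, related h z s).
{ intros z Hz; destruct (IH z (B z Hz)) as [s Hs]; exists s; apply Hh; auto. }
apply Hh' in Hab; destruct Hab as [Hab|[-> ->]].
- apply Hh in Hab; destruct Hab as [Ha (g & Hg & Rg)]; destruct (Rg a b Hg) as [K1 K2].
  assert (C : forall z s, z ∈ a -> (related h' z s <-> related g z s)).
  { intros z s Hz; destruct (K1 z Hz) as [s' Hs'].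
    assert (zt : z ∈ t) by exact (T a Ha z Hz).
    assert (Hs2 : related h z s') by (apply Hh; split; trivial; exists g; auto).
    split; intro K.
    - apply Hh' in K; destruct K as [K|[-> _]]; [|exfalso].
      + apply Hh in K; apply Hh in Hs2.
        rewrite (recursion_value_unique (proj2 K) (proj2 Hs2)); exact Hs'.
      + apply (well_founded_ind below_wf (fun x => ~ clos_trans M (@mem M) x x))
          with (a := x); [|apply B, zt].
        intros v Hv Hvv; exact (Hv v Hvv Hvv).
    - apply Hh'; left; apply Hh; split; trivial; exists g; auto. }
  split.
  + intros z Hz; destruct (K1 z Hz) as [s Hs]; exists s; apply C; trivial.
  + intro w; rewrite K2; split; intros (z & s & Hz & Hs & Hw); exists z, s;
      repeat split; trivial; apply C; trivial.
- assert (C : forall z s, z ∈ x -> (related h' z s <-> related h z s)).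
  { intros z s Hz; rewrite Hh'; split; [|auto]; intros [K|[-> _]]; trivial.
    exfalso; exact (mem_irrefl Hz). }
  split.
  + intros z Hz; destruct (V z (S z Hz)) as [s Hs]; exists s; apply C; trivial.
  + intro w; rewrite Hy; split.
    * intros (d & Hd & Hw); apply Hc in Hd; destruct Hd as (z & Hz & s & Hs & K).
      exists z, s; repeat split; [trivial|apply C; trivial|apply K, Hw].
    * intros (z & s & Hz & Hs & Hw); destruct (W_set s) as [d Hd].
      exists d; split; [|apply Hd, Hw]; apply Hc; exists z; split; trivial.
      exists s; split; [apply C; trivial|exact Hd].
Qed.

(** [H] is a function of the metatheory with a definable graph. The scheme has two uses: if [W s] is
    the next ordinal bound after [s], it produces suprema of bounds; if [W s] is the singleton of
    [(s, u)], it produces check names. *)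
Lemma recursion : exists H : M -> M,
  definable (fun e => H (e 0) = e 1) /\
  forall x w, w ∈ H x <-> exists z, z ∈ x /\ W (H z) w.
Proof.
destruct (functional_choice _ recursion_value_exists) as [H HH].
exists H; split.
- apply definable_ext with (fun e => recursion_value (e 0) (e 1)); [|definable].
  intro e; split; [intros <-; apply HH|apply recursion_value_unique, HH].
- intros x w; destruct (HH x) as (h & Hx & Hh); destruct (Hh _ _ Hx) as [T E].
  assert (C : forall z s, related h z s -> s = H z).
  { intros z s Hs; apply recursion_value_unique with z; [exists h; auto|apply HH]. }
  rewrite E; split.
  + intros (z & s & Hz & Hs & Hw); rewrite (C z s Hs) in Hw; eauto.
  + intros (z & Hz & Hw); destruct (T z Hz) as [s Hs]; exists z, s.
    repeat split; trivial; rewrite (C z s Hs); exact Hw.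
Qed.

End Recursion.

(** * Ordinals, cofinality and definable choice *)

Lemma ordinal_mem a b : is_ordinal a -> b ∈ a -> is_ordinal b.
Proof.
intros [T E] Hb; split; [apply E, Hb|]; intros c Hc; apply E, (T b Hb), Hc.
Qed.

Lemma ordinal_trichotomy a b :
  is_ordinal a -> is_ordinal b -> a ∈ b \/ a = b \/ b ∈ a.
Proof.
revert b; induction (M_wf a) as [a _ IHa]; intro b.
induction (M_wf b) as [b _ IHb]; intros Oa Ob; apply NNPP; intro N; apply N.
right; left; apply (zfc_extensionality M_ZFC); intro z; split; intro Hz.
- destruct (IHa z Hz b (ordinal_mem Oa Hz) Ob) as [H|[->|H]]; [trivial|tauto|].
  exfalso; apply N; right; right; exact (proj1 Oa z Hz b H).
- destruct (IHb z Hz Oa (ordinal_mem Ob Hz)) as [H|[->|H]]; [|tauto|trivial].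
  exfalso; apply N; left; exact (proj1 Ob z Hz a H).
Qed.

Lemma least_ordinal (Q : M -> Prop) a : is_ordinal a ->
  (exists b, b ∈ a /\ Q b) ->
  exists b, b ∈ a /\ Q b /\ forall c, c ∈ a -> Q c -> subset b c.
Proof.
intros Oa (b & Hb & Qb); revert Hb Qb; induction (M_wf b) as [b _ IH]; intros Hb Qb.
destruct (classic (exists c, c ∈ b /\ Q c)) as [(c & Hc & Qc)|N].
- apply (IH c Hc); trivial; exact (proj1 Oa b Hb c Hc).
- exists b; repeat split; trivial; intros c Hc Qc.
  destruct (ordinal_trichotomy (ordinal_mem Oa Hb) (ordinal_mem Oa Hc)) as [H|[->|H]].
  + exact (proj1 (ordinal_mem Oa Hc) b H).
  + intros z Hz; exact Hz.
  + exfalso; eauto.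
Qed.

Lemma subset_antisym a b : subset a b -> subset b a -> a = b.
Proof. intros H K; apply (zfc_extensionality M_ZFC); intro z; split; auto. Qed.

(** Meant for suprema: a union of ordinals is transitive, and a bound inside [g] makes it an element
    of [g]. *)
Lemma ordinal_bounded_mem g u b :
  is_ordinal g -> is_transitive u -> b ∈ g -> subset u b -> u ∈ g.
Proof.
intros Og Tu Hb Hu.
assert (Ou : is_ordinal u).
{ split; trivial; intros z Hz; apply Og, (proj1 Og b Hb), Hu, Hz. }
destruct (ordinal_trichotomy Ou Og) as [H|[->|H]]; [trivial| |]; exfalso.
- exact (mem_irrefl (Hu b Hb)).
- exact (mem_asym (Hu g H) Hb).
Qed.

(** The function on [m] is too short to be cofinal, so some [b] in [g] is included in no value; by
    trichotomy it includes every value. *)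
Lemma cofinality_bound k g m (R : M -> M -> Prop) :
  is_ordinal g -> is_cofinality k g -> m ∈ k ->
  definable (fun e => R (e 0) (e 1)) ->
  (forall x, x ∈ m -> exists! y, R x y) ->
  (forall x y, x ∈ m -> R x y -> y ∈ g) ->
  exists b, b ∈ g /\ forall x y, x ∈ m -> R x y -> subset y b.
Proof.
intros Og (_ & _ & C) Hm D F I.
destruct (function_set D F) as (f & Hf & E).
apply NNPP; intro N; apply (C m Hm); exists f; split; [split; trivial|].
- intros x y H; apply E in H; apply (I x y); apply H.
- intros b Hb; apply NNPP; intro N'; apply N; exists b; split; trivial.
  intros x y Hx Hy.
  destruct (ordinal_trichotomy (ordinal_mem Og Hb) (ordinal_mem Og (I x y Hx Hy)))
    as [H|[->|H]].
  + exfalso; apply N'; exists x, y; split; [apply E; auto|].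
    exact (proj1 (ordinal_mem Og (I x y Hx Hy)) b H).
  + intros z Hz; exact Hz.
  + exact (proj1 (ordinal_mem Og Hb) y H).
Qed.

(** One well-ordering of [a], kept as a parameter, selects the least element satisfying [Q]. Choice
    in the metatheory would not do: the selection has to be definable uniformly in the parameter of
    [Q] to enter a recursion of the model. *)
Lemma least_choice a : exists R : (M -> Prop) -> M -> Prop,
  (forall Q : M -> M -> Prop, definable (fun e => Q (e 0) (e 1)) ->
     definable (fun e => R (Q (e 0)) (e 1))) /\
  forall Q, definable (fun e => Q (e 0)) ->
    (forall x, R Q x -> x ∈ a /\ Q x) /\
    (forall x y, R Q x -> R Q y -> x = y) /\
    ((exists x, x ∈ a /\ Q x) -> exists x, R Q x).
Proof.
destruct (zfc_choice M_ZFC a) as [r (I & T & L & M0)].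
exists (fun Q x => x ∈ a /\ Q x /\ forall y, y ∈ a -> Q y -> y = x \/ related r x y); split.
- intros Q D; apply definable_and; [definable|apply definable_and].
  + exact D.
  + apply definable_all with
      (B := fun y e => y ∈ a -> Q (e 0) y -> y = e 1 \/ related r (e 1) y).
    repeat apply definable_imp; [definable| |definable].
    exact (definable_rename (fun n => match n with 0 => 1 | _ => 0 end) D).
- intros Q D; repeat split; try apply H.
  + intros x y (Hx & Qx & Lx) (Hy & Qy & Ly).
    destruct (Lx y Hy Qy) as [|H]; [auto|]; destruct (Ly x Hx Qx) as [|H']; [auto|].
    exfalso; apply (I x Hx); apply (T x y x); trivial.
  + intros (x & Hx & Qx); destruct (separation a D) as [b Hb].
    destruct (M0 b) as (y & Hy & Ly).
    * intros z Hz; apply Hb, Hz.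
    * exists x; apply Hb; auto.
    * exists y; apply Hb in Hy; repeat split; try apply Hy.
      intros z Hz Qz; apply Ly, Hb; auto.
Qed.

End SetTheory.

(** * Deciding a name to be a ground model set *)

Section ForcesEqual.
Context {M : eps_struct} (M_ZFC : ZFC M) (M_wf : well_founded (@mem M)).
Context (P : forcing M) (P_forcing : is_forcing P).
Implicit Types h p q s t x y z : M.

Lemma le_dom q p : le P q p -> q ∈ cond P.
Proof. intro H; apply (proj1 P_forcing q p H). Qed.

Lemma le_refl p : p ∈ cond P -> le P p p.
Proof. apply P_forcing. Qed.

Lemma le_trans p q r : le P p q -> le P q r -> le P p r.
Proof. apply P_forcing. Qed.

Lemma definable_le (t t' : (nat -> M) -> M) :
  definable_term t -> definable_term t' -> definable (fun e => le P (t e) (t' e)).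
Proof. apply definable_rel2; unfold le; definable. Qed.
#[local] Hint Resolve definable_le : definable.

Lemma definable_compatible (t t' : (nat -> M) -> M) :
  definable_term t -> definable_term t' ->
  definable (fun e => compatible P (t e) (t' e)).
Proof. apply definable_rel2; unfold compatible; definable. Qed.
#[local] Hint Resolve definable_compatible : definable.

(** [p] forces [x = y], where [x] is a name and [y] a ground model set, in terms
    of the same relation [H] for the names in [x] and the elements of [y]. *)
Definition forces_clause (H : M -> M -> M -> Prop) x p y : Prop :=
  p ∈ cond P /\
  (forall s q p', related x s q -> le P p' p -> le P p' q ->
     exists p'' z, le P p'' p' /\ z ∈ y /\ H s p'' z) /\
  (forall z p', z ∈ y -> le P p' p ->
     exists p'' s q, le P p'' p' /\ related x s q /\ le P p'' q /\ H s p'' z).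

Definition triple h x p y : Prop := exists w, is_opair w x p /\ related h w y.

(** The clause is monotone in [H] and names are well-founded, so its only
    fixed point is its greatest one, which needs no recursion inside [M]. *)
Definition forces_eq x p y : Prop :=
  exists h, triple h x p y /\
    forall x' p' y', triple h x' p' y' -> forces_clause (triple h) x' p' y'.

Lemma definable_forces_eq (t t' t'' : (nat -> M) -> M) :
  definable_term t -> definable_term t' -> definable_term t'' ->
  definable (fun e => forces_eq (t e) (t' e) (t'' e)).
Proof.
apply definable_rel3; unfold forces_eq, forces_clause, triple; definable.
Qed.
#[local] Hint Resolve definable_forces_eq : definable.

Lemma forces_clause_mono (H K : M -> M -> M -> Prop) x p y :
  (forall s q p' z, related x s q -> z ∈ y -> H s p' z -> K s p' z) ->
  forces_clause H x p y -> forces_clause K x p y.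
Proof.
intros I (Hp & A & B); split; [trivial|split].
- intros s q p' Hs L L'; destruct (A s q p' Hs L L') as (p'' & z & Lp & Hz & Hh).
  exists p'', z; eauto.
- intros z p' Hz L; destruct (B z p' Hz L) as (p'' & s & q & Lp & Hs & Lq & Hh).
  exists p'', s, q; eauto 6.
Qed.

Lemma forces_eq_unfold x p y : forces_eq x p y -> forces_clause forces_eq x p y.
Proof.
intros (h & H & Hh); eapply forces_clause_mono; [|apply Hh, H].
intros s q p' z _ _ K; exists h; auto.
Qed.

(** The clause at [(x, p, y)] appeals to many instances, each with its own witness. A single witness
    consists of all true triples over a transitive set containing [x] and [y], with [((x, p), y)]
    added. *)
Lemma forces_eq_fold x p y : forces_clause forces_eq x p y -> forces_eq x p y.
Proof.
intro H; destruct (zfc_pairing M_ZFC x y) as [c Hc].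
destruct (closure_exists M_ZFC M_wf c) as (a & (T & S & _) & _).
assert (Hx : x ∈ a) by (apply S, Hc; auto).
assert (Hy : y ∈ a) by (apply S, Hc; auto).
destruct (pairs_bounded M_ZFC a (cond P)) as [b Hb].
destruct (relation_set M_ZFC (R := fun w v => exists s p', is_opair w s p' /\
  s ∈ a /\ p' ∈ cond P /\ forces_eq s p' v) b a) as (h & _ & Hh); [definable|].
assert (Th : forall s p' v, triple h s p' v <->
    s ∈ a /\ p' ∈ cond P /\ v ∈ a /\ forces_eq s p' v).
{ intros s p' v; split.
  - intros (w & Hw & K); apply Hh in K.
    destruct K as (_ & Hv & s' & p'' & Hw' & K).
    destruct (opair_inj M_ZFC Hw Hw') as [-> ->]; tauto.
  - intros (Hs & Hp & Hv & K); destruct (opair_exists M_ZFC s p') as [w Hw].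
    exists w; split; trivial; apply Hh; repeat split; trivial; [eauto|].
    exists s, p'; auto. }
destruct (opair_exists M_ZFC x p) as [w Hw].
destruct (related_insert M_ZFC h w y) as [h' Hh'].
assert (I : forall s p' v, triple h s p' v -> triple h' s p' v).
{ intros s p' v (w' & Hw' & K); exists w'; split; trivial; apply Hh'; auto. }
assert (F : forall s p' v, s ∈ a -> v ∈ a ->
    forces_clause forces_eq s p' v -> forces_clause (triple h') s p' v).
{ intros s p' v Hs Hv; apply forces_clause_mono.
  intros s' q p'' z Hs' Hz K; apply I, Th; repeat split; trivial.
  - apply (transitive_related M_ZFC T Hs Hs').
  - apply forces_eq_unfold in K; apply K.
  - exact (T v Hv z Hz). }
exists h'; split; [exists w; split; [|apply Hh']; auto|].
intros s p' v (w' & Hw' & K); apply Hh' in K; destruct K as [K|[-> ->]].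
- destruct (proj1 (Th s p' v)) as (Hs & _ & Hv & K'); [exists w'; auto|].
  apply F; trivial; apply forces_eq_unfold, K'.
- destruct (opair_inj M_ZFC Hw Hw') as [<- <-]; apply F; trivial.
Qed.

Lemma forces_eq_le x p p' y : forces_eq x p y -> le P p' p -> forces_eq x p' y.
Proof.
intros H L; apply forces_eq_unfold in H; destruct H as (_ & A & B).
apply forces_eq_fold; split; [exact (le_dom L)|split].
- intros s q r Hs L' L''; apply (A s q r); trivial; exact (le_trans L' L).
- intros z r Hz L'; apply (B z r); trivial; exact (le_trans L' L).
Qed.

(** For [z] in [y], some extension of [p] forces a name [s] from [x] to equal [z], and a further one
    forces the same [s] to equal an element of [y']; uniqueness at [s] identifies the two. *)
Lemma forces_eq_subset x p y y' :
  (forall s z z' q p', related x s q -> forces_eq s p' z -> forces_eq s p' z' -> z = z') ->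
  forces_eq x p y -> forces_eq x p y' -> subset y y'.
Proof.
intros U H H' z Hz.
apply forces_eq_unfold in H, H'; destruct H as (Hp & _ & B), H' as (_ & A & _).
destruct (B z p Hz (le_refl Hp)) as (p1 & s & q & L & Hs & Lq & K).
destruct (A s q p1 Hs L Lq) as (p2 & z' & L' & Hz' & K').
rewrite (U s z z' q p2 Hs (forces_eq_le K L') K'); exact Hz'.
Qed.

Lemma forces_eq_unique x p y y' : forces_eq x p y -> forces_eq x p y' -> y = y'.
Proof.
revert p y y'; induction (below_wf M_wf x) as [x _ IH]; intros p y y' H H'.
assert (U : forall s z z' q p', related x s q ->
    forces_eq s p' z -> forces_eq s p' z' -> z = z').
{ intros s z z' q p' Hs; apply IH, (related_below M_ZFC Hs). }
apply (subset_antisym M_ZFC); eapply forces_eq_subset; eauto.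
Qed.

(** * Generic filters and definable sets of conditions *)

Section Generic.
Context (G : M -> Prop) (G_generic : is_generic P G).

Lemma generic_cond p : G p -> p ∈ cond P.
Proof. apply G_generic. Qed.

Lemma generic_up p q : G q -> le P q p -> G p.
Proof. apply G_generic. Qed.

Lemma generic_directed p q : G p -> G q -> exists r, G r /\ le P r p /\ le P r q.
Proof. apply G_generic. Qed.

(** The conditions that satisfy [A] or have no extension satisfying it are dense, and definability
    makes them a set of the model, as [is_generic] requires. *)
Lemma generic_decides (A : M -> Prop) : definable (fun e => A (e 0)) ->
  exists p, G p /\ (A p \/ forall q, le P q p -> ~ A q).
Proof.
intro D.
destruct (separation M_ZFC (Q := fun p => A p \/ forall q, le P q p -> ~ A q) (cond P))
  as [d Hd].
{ apply definable_or; [exact D|].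
  apply definable_all with (B := fun q e => le P q (e 0) -> ~ A q).
  apply definable_imp; [definable|apply definable_not, D]. }
destruct (proj2 G_generic d) as (p & Hp & Gp).
- split; [intros p Hp; apply Hd, Hp|]; intros p Hp.
  destruct (classic (exists q, le P q p /\ A q)) as [(q & L & Aq)|N].
  + exists q; split; trivial; apply Hd; split; [exact (le_dom L)|auto].
  + exists p; split; [|apply le_refl, Hp]; apply Hd; split; trivial.
    right; intros q L Aq; eauto.
- exists p; split; trivial; apply Hd, Hp.
Qed.

(** Otherwise [G] contains a condition no extension of which satisfies [A]; a common extension of it
    and [p] contradicts density below [p]. *)
Lemma generic_meets (A : M -> Prop) p : definable (fun e => A (e 0)) -> G p ->
  (forall p', le P p' p -> exists q, le P q p' /\ A q) -> exists q, G q /\ A q.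
Proof.
intros D Gp H; destruct (generic_decides D) as (q & Gq & [Aq|N]); [eauto|].
destruct (generic_directed Gp Gq) as (r & _ & Lp & Lq).
destruct (H r Lp) as (q' & L & Aq'); exfalso; exact (N q' (le_trans L Lq) Aq').
Qed.

End Generic.
End ForcesEqual.

#[export] Hint Resolve definable_le definable_compatible definable_forces_eq : definable.

Lemma valuation (V : background -> Prop) (V_ZFC : ZFC (inner V)) (G : inner V -> Prop) :
  exists val : inner V -> background,
    (forall t y, y ∈ val t <-> exists s p, G p /\ related t s p /\ y = val s) /\
    forall t x, is_value G t x <-> x = val t.
Proof.
destruct (functional_choice _ (is_value_exists V_ZFC G)) as [val Hval].
exists val; split.
- intros t y; destruct (Hval t) as [t v x Hv Hx]; rewrite Hx.
  split; intros (s & p & Gp & Hs & ->); exists s, p; repeat split; trivial.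
  + exact (is_value_unique (Hv s p Gp Hs) (Hval s)).
  + exact (is_value_unique (Hval s) (Hv s p Gp Hs)).
- intros t x; split; [intro H; exact (is_value_unique H (Hval t))|intros ->; auto].
Qed.

(** * The truth lemma for equality with a ground model set *)

Section Truth.
Context (V : background -> Prop) (V_transitive : transitive_class V) (V_ZFC : ZFC (inner V)).
Context (P : forcing (inner V)) (P_forcing : is_forcing P).
Context (G : inner V -> Prop) (G_generic : is_generic P G).
Context (val : inner V -> background).
Context (valE : forall t y, y ∈ val t <-> exists s p, G p /\ related t s p /\ y = val s).

Let V_wf := @inner_wf V.

(** Each half of the forcing clause is a density statement below a condition of [G]; genericity
    realizes it, and induction on names evaluates the result. *)
Lemma forces_eq_sound t p u : G p -> forces_eq P t p u -> val t = proj1_sig u.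
Proof.
revert p u; induction (below_wf V_wf t) as [t _ IH]; intros p u Gp H.
apply forces_eq_unfold in H; destruct H as (_ & A & B).
apply hset_ext; intro v; rewrite valE; split.
- intros (s & q & Gq & Hs & ->).
  destruct (generic_directed G_generic Gp Gq) as (r & Gr & Lp & Lq).
  destruct (generic_meets V_ZFC P_forcing G_generic
    (A := fun r => exists z, z ∈ u /\ forces_eq P s r z) (p := r)) as (r' & Gr' & z & Hz & K);
    [definable|trivial| |].
  + intros r' L; destruct (A s q r' Hs) as (r'' & z & L' & Hz & K);
      [eapply le_trans; eauto|eapply le_trans; eauto|].
    exists r''; eauto.
  + rewrite (IH s (related_below V_ZFC Hs) r' z Gr' K); exact Hz.
- intro Hv; pose (z := exist V v (V_transitive (proj2_sig u) Hv) : inner V).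
  destruct (generic_meets V_ZFC P_forcing G_generic
    (A := fun r => exists s q, related t s q /\ le P r q /\ forces_eq P s r z) (p := p))
    as (r & Gr & s & q & Hs & Lq & K); [definable|trivial| |].
  + intros p' L; destruct (B z p' Hv L) as (p'' & s & q & L' & Hs & Lq & K).
    exists p''; eauto 6.
  + exists s, q; split; [exact (generic_up G_generic Gr Lq)|split; trivial].
    symmetry; exact (IH s (related_below V_ZFC Hs) r z Gr K).
Qed.

(** Two conditions of [G] settle whether the halves of the forcing clause fail. A failure witnessed
    in [G] contradicts [val t = u] by the inductive hypothesis; so neither half fails, and a common
    extension forces the equality. *)
Lemma forces_eq_complete t (u : inner V) : val t = proj1_sig u -> exists p, G p /\ forces_eq P t p u.
Proof.
revert u; induction (below_wf V_wf t) as [t _ IH]; intros u E.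
destruct (generic_decides V_ZFC P_forcing G_generic (A := fun p => exists s q,
  related t s q /\ le P p q /\ forall z p' : inner V, z ∈ u -> le P p' p -> ~ forces_eq P s p' z))
  as (p1 & G1 & H1); [definable|].
destruct (generic_decides V_ZFC P_forcing G_generic (A := fun p => exists z : inner V, z ∈ u /\
  forall s q p', related t s q -> le P p' p -> le P p' q -> ~ forces_eq P s p' z))
  as (p2 & G2 & H2); [definable|].
destruct (generic_directed G_generic G1 G2) as (p & Gp & L1 & L2).
exists p; split; trivial; apply (forces_eq_fold V_ZFC V_wf).
split; [exact (generic_cond G_generic Gp)|].
destruct H1 as [(s & q & Hs & Lq & N)|H1]; [exfalso|].
{ assert (Hv : val s ∈ proj1_sig u).
  { rewrite <- E; apply valE; exists s, q; repeat split; trivial.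
    exact (generic_up G_generic G1 Lq). }
  pose (z := exist V (val s) (V_transitive (proj2_sig u) Hv) : inner V).
  destruct (IH s (related_below V_ZFC Hs) z eq_refl) as (r & Gr & K).
  destruct (generic_directed G_generic G1 Gr) as (r' & _ & L & L').
  exact (N z r' Hv L (forces_eq_le V_ZFC V_wf P_forcing K L')). }
destruct H2 as [(z & Hz & N)|H2]; [exfalso|].
{ assert (Hv : proj1_sig z ∈ val t) by (rewrite E; exact Hz).
  apply valE in Hv; destruct Hv as (s & q & Gq & Hs & Ez).
  destruct (IH s (related_below V_ZFC Hs) z (eq_sym Ez)) as (r & Gr & K).
  destruct (generic_directed G_generic G2 Gr) as (r' & Gr' & L & L').
  destruct (generic_directed G_generic Gq Gr') as (r'' & _ & L'' & L3).
  apply (N s q r'' Hs); trivial; [eapply le_trans; eauto|].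
  apply (forces_eq_le V_ZFC V_wf P_forcing K); eapply le_trans; eauto. }
split.
- intros s q p' Hs L Lq; apply NNPP; intro N; apply (H1 p' (le_trans P_forcing L L1)).
  exists s, q; repeat split; trivial; intros z p'' Hz L' K; apply N; eauto.
- intros z p' Hz L; apply NNPP; intro N; apply (H2 p' (le_trans P_forcing L L2)).
  exists z; split; trivial; intros s q p'' Hs L' Lq K; apply N; exists p'', s, q; auto.
Qed.

End Truth.

(** * Chain condition and bounded conditions *)

Section ChainCondition.
Context {M : eps_struct} (M_ZFC : ZFC M) (M_wf : well_founded (@mem M)).
Context (P : forcing M) (P_forcing : is_forcing P).
Context (g k : M) (g_ordinal : is_ordinal g) (k_cf : is_cofinality k g).
Context (P_cc : chain_condition P k).
Context (bounded : M -> M -> Prop).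
Context (bounded_definable : definable (fun e => bounded (e 0) (e 1))).
Context (bounded_mono : forall p d d', subset d d' -> bounded p d -> bounded p d').
Context (bounded_exists : forall p, p ∈ cond P -> exists d, d ∈ g /\ bounded p d).

Let definable_bounded (t t' : (nat -> M) -> M) : definable_term t ->
  definable_term t' -> definable (fun e => bounded (t e) (t' e)).
Proof. apply definable_rel2, bounded_definable. Qed.
#[local] Hint Resolve definable_bounded : definable.

Lemma compatible_sym p q : compatible P p q -> compatible P q p.
Proof. intros (r & Hr & L & L'); exists r; auto. Qed.

Lemma compatible_refl p : p ∈ cond P -> compatible P p p.
Proof. intro Hp; exists p; repeat split; trivial; apply (le_refl P_forcing Hp). Qed.

(** Otherwise recursion along [k = cf g] builds an antichain of size [k], each
    member of which is incompatible with all the elements of [D] bounded by the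
    supports of the previous members. *)
Lemma bounded_predense (D : M -> Prop) : definable (fun e => D (e 0)) ->
  (forall p, D p -> p ∈ cond P) ->
  exists d, d ∈ g /\
    forall p, D p -> exists a, D a /\ bounded a d /\ compatible P p a.
Proof.
intros D_definable D_cond; apply NNPP; intro N.
assert (definable_D : forall t, definable_term t -> definable (fun e => D (t e))).
{ intro t; apply definable_rel1, D_definable. }
(* By [N], every [d] in [g] admits a [p] with [new d p]. *)
pose (new d p := D p /\ forall a, D a -> bounded a d -> ~ compatible P p a).
assert (D_new : definable (fun e => new (e 0) (e 1))) by (unfold new; definable).
destruct (least_choice M_ZFC (cond P)) as (choose & D_choose & H_choose).
pose (pick d p := choose (new d) p).
assert (D_pick : forall t t', definable_term t -> definable_term t' ->
    definable (fun e => pick (t e) (t' e))).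
{ intros t t'; apply definable_rel2; unfold pick; apply D_choose, D_new. }
assert (new_definable : forall d, definable (fun e => new d (e 0))).
{ intro d; unfold new; definable. }
assert (pick_new : forall d p, pick d p -> p ∈ cond P /\ new d p).
{ intros d p; apply (H_choose _ (new_definable d)). }
assert (pick_unique : forall d p p', pick d p -> pick d p' -> p = p').
{ intros d p p'; apply (H_choose _ (new_definable d)). }
assert (pick_exists : forall d, d ∈ g -> exists p, pick d p).
{ intros d Hd; apply (H_choose _ (new_definable d)); apply NNPP; intro N'; apply N.
  exists d; split; trivial; intros p Dp; apply NNPP; intro K; apply N'.
  exists p; split; [auto|split; trivial]; intros a Da Ba C; apply K; eauto. }
(* The bound of the condition picked at [s] is taken least in order to be unique. *)
pose (next s d := d ∈ g /\ exists p, pick s p /\ bounded p d /\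
  forall d', d' ∈ g -> bounded p d' -> subset d d').
assert (D_next : forall t t', definable_term t -> definable_term t' ->
    definable (fun e => next (t e) (t' e))).
{ intros t t'; apply definable_rel2; unfold next.
  definable. }
assert (next_unique : forall s d d', next s d -> next s d' -> d = d').
{ intros s d d' (Hd & p & Hp & B & L) (Hd' & p' & Hp' & B' & L').
  rewrite (pick_unique s p' p) in * by trivial.
  apply (subset_antisym M_ZFC); auto. }
assert (next_exists : forall s, s ∈ g -> exists d, next s d).
{ intros s Hs; destruct (pick_exists s Hs) as [p Hp].
  destruct (least_ordinal M_ZFC M_wf (Q := fun d => bounded p d) g_ordinal) as (d & Hd & B & L).
  - apply bounded_exists, (pick_new s p Hp).
  - exists d; split; trivial; exists p; auto. }
(* [H x] becomes the supremum of the bounds of the conditions picked at the stages in [x]. The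
   recursion runs over all sets, so a stage without a next bound contributes the empty set. *)
destruct (recursion M_ZFC M_wf (W := fun s w => exists d, next s d /\ w ∈ d))
  as (H & D_H & HE); [definable| |].
{ intro s; destruct (classic (exists d, next s d)) as [[d Hd]|N'].
  - exists d; intro w; split; [eauto|]; intros (d' & Hd' & Hw).
    rewrite (next_unique s d d'); trivial.
  - destruct (separation M_ZFC (Q := fun _ => False) s) as [c Hc].
    + apply definable_ext with (fun e => e 0 ∈ e 0 /\ ~ e 0 ∈ e 0); [|definable].
      intro e; tauto.
    + exists c; intro w; rewrite Hc; split; [tauto|].
      intros (d & Hd & _); exfalso; eauto. }
assert (Ht : forall t t', definable_term t -> definable_term t' ->
    definable (fun e => H (t e) = t' e)).
{ intros t t'; apply (definable_rel2 (R := fun x y => H x = y)), D_H. }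
destruct k_cf as (k_ordinal & _).
assert (H_mem : forall x, x ∈ k -> H x ∈ g).
{ intro x; induction (M_wf x) as [x _ IH]; intro Hx.
  assert (IH' : forall z, z ∈ x -> H z ∈ g).
  { intros z Hz; apply IH; trivial; exact (proj1 k_ordinal x Hx z Hz). }
  (* Here [x ∈ k = cf g] enters: the bounds of the earlier picks form a function on [x], which
     cannot be cofinal in [g]. *)
  destruct (cofinality_bound (R := fun z d => exists s, H z = s /\ next s d)
    M_ZFC M_wf g_ordinal k_cf Hx) as (b & Hb & B); [definable| | |].
  - intros z Hz; destruct (next_exists (H z) (IH' z Hz)) as [d Hd].
    exists d; split; [eauto|]; intros d' (s & <- & Hd'); eauto.
  - intros z d _ (s & _ & Hd & _); exact Hd.
  - apply (ordinal_bounded_mem M_ZFC M_wf g_ordinal (b := b)); trivial.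
    + intros w Hw v Hv; apply HE in Hw; destruct Hw as (z & Hz & d & Hd & Hw).
      apply HE; exists z; split; trivial; exists d; split; trivial.
      exact (proj1 (ordinal_mem g_ordinal (proj1 Hd)) w Hw v Hv).
    + intros w Hw; apply HE in Hw; destruct Hw as (z & Hz & d & Hd & Hw).
      apply (B z d Hz); eauto. }
destruct (function_set M_ZFC (R := fun x p => exists s, H x = s /\ pick s p) (d := k))
  as (f & Hf & fE); [definable| |].
{ intros x Hx; destruct (pick_exists (H x) (H_mem x Hx)) as [p Hp].
  exists p; split; [eauto|]; intros p' (s & <- & Hp'); eauto. }
(* The earlier condition has its bound included in [H x], and the later one is new at [H x]. *)
assert (apart : forall x x' p p', x' ∈ x -> related f x p -> related f x' p' ->
    ~ compatible P p p').
{ intros x x' p p' Hx' K K'; apply fE in K, K'.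
  destruct K as (Hx & _ & <- & K), K' as (_ & _ & <- & K').
  destruct (pick_new _ _ K) as (_ & _ & A), (pick_new _ _ K') as (_ & Dp' & _).
  apply A; trivial.
  assert (Hx'k : x' ∈ k) by exact (proj1 k_ordinal x Hx x' Hx').
  destruct (next_exists (H x') (H_mem x' Hx'k)) as [d Hd].
  pose proof Hd as (_ & q & Hq & B & _).
  rewrite (pick_unique _ _ _ K' Hq); apply (bounded_mono (d := d)); trivial.
  intros w Hw; apply HE; eauto. }
destruct (replacement M_ZFC (R := fun x p => related f x p) (a := k)) as [A HA]; [definable| |].
{ intros x p p' Hx K K'; destruct (proj2 Hf x Hx) as (q & _ & U).
  rewrite <- (U p K); apply U, K'. }
destruct (P_cc (A := A)) as (p & p' & Hp & Hp' & Npp & C).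
- intros p Hp; apply HA in Hp; destruct Hp as (x & _ & K); apply fE in K.
  destruct K as (_ & s & _ & K); apply (pick_new s p K).
- exists f; split; [split; trivial|].
  + intros x p K; apply HA; exists x; split; trivial; apply fE in K; apply K.
  (* Injectivity comes from [apart], since a condition is compatible with itself. *)
  + intros x x' p K K'.
    assert (Hp : p ∈ cond P).
    { apply fE in K; destruct K as (_ & s & _ & K); apply (pick_new s p K). }
    pose proof (compatible_refl Hp) as C.
    destruct (ordinal_trichotomy M_ZFC M_wf (a := x) (b := x')) as [Hx|[Hx|Hx]]; trivial.
    1, 2: apply fE in K, K'; eapply ordinal_mem; [exact k_ordinal|tauto].
    * exfalso; exact (apart x' x p p Hx K' K C).
    * exfalso; exact (apart x x' p p Hx K K' C).
- apply HA in Hp, Hp'; destruct Hp as (x & Hx & K), Hp' as (x' & Hx' & K').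
  destruct (ordinal_trichotomy M_ZFC M_wf (ordinal_mem k_ordinal Hx)
    (ordinal_mem k_ordinal Hx')) as [I|[E|I]].
  + exact (apart x' x p' p I K' K (compatible_sym C)).
  + subst x'; apply Npp; destruct (proj2 Hf x Hx) as (q & _ & U).
    rewrite <- (U p K); apply U, K'.
  + exact (apart x x' p p' I K K' C).
Qed.

(** The least good bound is a definable function of [x] on [n ∈ k], hence bounded in [g], and
    [bounded_mono] passes to the common bound. *)
Lemma bounded_predense_family (n : M) (D : M -> M -> Prop) : n ∈ k ->
  definable (fun e => D (e 0) (e 1)) -> (forall x p, D x p -> p ∈ cond P) ->
  exists d, d ∈ g /\ forall x p, x ∈ n -> D x p ->
    exists a, D x a /\ bounded a d /\ compatible P p a.
Proof.
intros Hn D_definable D_cond.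
assert (definable_D : forall t t', definable_term t -> definable_term t' ->
    definable (fun e => D (t e) (t' e))).
{ intros t t'; apply definable_rel2, D_definable. }
pose (good x d := forall p, D x p -> exists a, D x a /\ bounded a d /\ compatible P p a).
destruct (cofinality_bound M_ZFC M_wf (R := fun x d => d ∈ g /\ good x d /\
  forall d', d' ∈ g -> good x d' -> subset d d') g_ordinal k_cf Hn) as (b & Hb & B).
- unfold good; definable.
- intros x Hx.
  destruct (bounded_predense (D := D x)) as (d0 & Hd0 & G0); [definable|eauto|].
  destruct (least_ordinal M_ZFC M_wf (Q := good x) g_ordinal) as (d & Hd & Gd & L); [eauto|].
  exists d; split; [auto|]; intros d' (Hd' & Gd' & L').
  apply (subset_antisym M_ZFC); auto.
- intros x d _ K; exact (proj1 K).
- exists b; split; trivial; intros x p Hx Dp.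
  destruct (bounded_predense (D := D x)) as (d0 & Hd0 & G0); [definable|eauto|].
  destruct (least_ordinal M_ZFC M_wf (Q := good x) g_ordinal) as (d & Hd & Gd & L); [eauto|].
  destruct (Gd p Dp) as (a & Da & Ba & C); exists a; repeat split; trivial.
  apply (bounded_mono (d := d)); trivial; apply (B x d Hx); auto.
Qed.

End ChainCondition.

(** * Restrictions in a product *)

Section Restriction.
Context {M : eps_struct} (M_ZFC : ZFC M).
Context (I : M) (F : family M) (P : forcing M) (P_product : product_forcing I F P).
Implicit Types p q r J : M.

Lemma function_ext f f' : is_function f I -> is_function f' I ->
  (forall i x, related f i x -> related f' i x) -> f = f'.
Proof.
intros [E T] [E' T'] S; apply (zfc_extensionality M_ZFC); intro z; split; intro Hz.
- destruct (E z Hz) as (i & x & _ & Hx); rewrite <- (related_opair M_ZFC _ Hx).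
  apply S; exists z; auto.
- destruct (E' z Hz) as (i & x & Hi & Hx); rewrite <- (related_opair M_ZFC _ Hx).
  destruct (T i Hi) as (y & Hy & _), (T' i Hi) as (y' & _ & U).
  rewrite <- (U x), (U y); [exact Hy|apply S, Hy|exists z; auto].
Qed.

Lemma function_fun f i x y :
  is_function f I -> i ∈ I -> related f i x -> related f i y -> x = y.
Proof.
intros [_ T] Hi Hx Hy; destruct (T i Hi) as (z & _ & U).
rewrite <- (U x Hx); apply U, Hy.
Qed.

Lemma function_dom f i x : is_function f I -> related f i x -> i ∈ I.
Proof.
intros [E _] (z & Hz & zf); destruct (E z zf) as (j & y & Hj & Hz').
destruct (opair_inj M_ZFC Hz Hz') as [-> _]; exact Hj.
Qed.

Lemma factor_exists i : i ∈ I -> exists Q, factor F i Q.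
Proof.
intro Hi; destruct (prod_family P_product) as ([_ A] & [_ B] & [_ C] & _).
destruct (A i Hi) as (c & Hc & _), (B i Hi) as (o & Ho & _), (C i Hi) as (u & Hu & _).
exists (Forcing c o u); split; [|split]; assumption.
Qed.

Lemma cond_function p : p ∈ cond P -> is_function p I.
Proof. intro Hp; apply (prod_selection P_product Hp). Qed.

Lemma restriction_unique r r' p J : p ∈ cond P ->
  is_restriction I F r p J -> is_restriction I F r' p J -> r = r'.
Proof.
intros Hp (Fr & A & B) (Fr' & A' & B'); apply function_ext; trivial; intros i x Hx.
pose proof (function_dom Fr Hx) as Hi.
destruct (classic (i ∈ J)) as [HJ|HJ].
- destruct (proj2 (cond_function Hp) i Hi) as (y & Hy & _).
  rewrite (function_fun Fr Hi Hx (A i y Hi HJ Hy)); auto.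
- destruct (factor_exists Hi) as [Q HQ].
  rewrite (function_fun Fr Hi Hx (B i Q Hi HJ HQ)); auto.
Qed.

Lemma restriction_cond r p J : p ∈ cond P -> subset J I ->
  is_restriction I F r p J -> r ∈ cond P.
Proof.
intros Hp S H; destruct (prod_restriction P_product Hp S) as (r' & H' & Hr').
rewrite (restriction_unique Hp H H'); exact Hr'.
Qed.

Lemma restriction_le r p J : p ∈ cond P -> subset J I ->
  is_restriction I F r p J -> le P p r.
Proof.
intros Hp S H; pose proof (restriction_cond Hp S H) as Hr; destruct H as (Fr & A & B).
apply (prod_le P_product Hp Hr); intros i Q y x Hi HQ Hy Hx.
pose proof (proj2 (prod_selection P_product Hp) i Q y Hi HQ Hy) as Qy.
pose proof (prod_family P_product) as (_ & _ & _ & K).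
destruct (K i Q Hi HQ) as (_ & R & _ & _ & _ & T).
destruct (classic (i ∈ J)) as [HJ|HJ].
- rewrite (function_fun Fr Hi Hx (A i y Hi HJ Hy)); auto.
- rewrite (function_fun Fr Hi Hx (B i Q Hi HJ HQ)); auto.
Qed.

Lemma restriction_idem r p J : is_restriction I F r p J -> is_restriction I F r r J.
Proof. intros (Fr & _ & B); split; [|split]; auto. Qed.

Lemma restriction_mono p J J' : subset J J' ->
  is_restriction I F p p J -> is_restriction I F p p J'.
Proof. intros S (Fp & _ & B); split; [|split]; auto. Qed.

Lemma definable_restriction (t t' t'' : (nat -> M) -> M) :
  definable_term t -> definable_term t' -> definable_term t'' ->
  definable (fun e => is_restriction I F (t e) (t' e) (t'' e)).
Proof.
apply definable_rel3; unfold is_restriction, is_function, factor; cbn [cond ord one].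
definable.
Qed.

Section Filter.
Context (J : M) (J_sub : subset J I) (G : M -> Prop) (G_filter : is_filter P G).

Lemma restrict_cond r : restrict I F (fun p => p ∈ cond P) J r -> r ∈ cond P.
Proof. intros (p & Hp & H); exact (restriction_cond Hp J_sub H). Qed.

(** [G|J] is the trace of [G] on [P|J]: a condition lies below its restriction, so upward closure
    gives one direction, and idempotence of restriction gives the other. *)
Lemma restrict_filter r : restrict I F (fun p => p ∈ cond P) J r ->
  (restrict I F G J r <-> G r).
Proof.
destruct G_filter as (C & _ & U & _); intros (p & Hp & H); split.
- intros (q & Gq & Hq); apply (U r q Gq), (restriction_le (C q Gq) J_sub Hq).
- intro Gr; exists r; split; [trivial|exact (restriction_idem H)].
Qed.

(** Supplies the condition attached to check names. The restriction of any member of [G] serves, so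
    [u] may differ from the maximal element. *)
Lemma restrict_one : exists u,
  restrict I F (fun p => p ∈ cond P) J u /\ restrict I F G J u.
Proof.
destruct G_filter as (C & [p Gp] & U & _).
destruct (prod_restriction P_product (C p Gp) J_sub) as (u & Hu & _).
exists u; split; exists p; auto.
Qed.

End Filter.
End Restriction.

#[export] Hint Resolve definable_restriction : definable.

(** * Generic extensions *)

Section Extension.
Context (V : background -> Prop) (V_ZFC : ZFC (inner V)).

(** A name over [C] mentions only conditions in [C], where the two filters agree; the same name thus
    has the same value. *)
Lemma extension_mono (C C' G G' : inner V -> Prop) :
  (forall p, C p -> C' p) -> (forall p, C p -> (G p <-> G' p)) ->
  forall x, extension C G x -> extension C' G' x.
Proof.
intros CC' GG' x (t & Nt & Ht); exists t; split.
{ clear Ht; induction Nt as [t E _ IH]; split; trivial.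
  intros z Hz; destruct (E z Hz) as (s & p & Hz' & Cp); eauto. }
revert x Ht; induction Nt as [t E _ IH]; intros x Ht.
destruct Ht as [t v x Hv Hx].
assert (Ct : forall s p, related t s p -> C p).
{ intros s p (z & Hz & zt); destruct (E z zt) as (s' & p' & Hz' & Cp).
  destruct (opair_inj V_ZFC Hz Hz') as [_ ->]; exact Cp. }
apply IsValue with v.
- intros s p Gp Hs; apply (IH s p Hs), (Hv s p); trivial; apply GG'; eauto.
- intro y; rewrite Hx; split; intros (s & p & Gp & Hs & ->); exists s, p;
    repeat split; trivial; apply GG'; eauto.
Qed.

Lemma check_names (u : inner V) : exists check : inner V -> inner V,
  definable (fun e => check (e 0) = e 1) /\
  (forall x w, w ∈ check x <-> exists z, z ∈ x /\ is_opair w (check z) u) /\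
  (forall x s p, related (check x) s p <-> p = u /\ exists z, z ∈ x /\ s = check z).
Proof.
destruct (recursion V_ZFC (@inner_wf V) (W := fun s w => is_opair w s u))
  as (check & D & E); [definable| |].
{ intro s; destruct (opair_exists V_ZFC s u) as [w Hw].
  destruct (zfc_pairing V_ZFC w w) as [c Hc]; exists c; intro v; rewrite (Hc v); split.
  - intros [->| ->]; exact Hw.
  - intro Hv; left; exact (opair_unique V_ZFC Hv Hw). }
exists check; split; [trivial|split; [trivial|]]; intros x s p; split.
- intros (w & Hw & K); apply E in K; destruct K as (z & Hz & Hw').
  destruct (opair_inj V_ZFC Hw Hw') as [-> ->]; eauto.
- intros (-> & z & Hz & ->); destruct (opair_exists V_ZFC (check z) u) as [w Hw].
  exists w; split; trivial; apply E; eauto.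
Qed.

End Extension.

(** * Absoluteness of ordered pairs *)

Section Absoluteness.
Context (V : background -> Prop) (V_transitive : transitive_class V) (V_ZFC : ZFC (inner V)).

Lemma upair_absolute (c a b : inner V) : is_upair c a b ->
  is_upair (proj1_sig c : background) (proj1_sig a) (proj1_sig b).
Proof.
intros H z; split.
- intro Hz; pose (z' := exist V z (V_transitive (proj2_sig c) Hz) : inner V).
  destruct (proj1 (H z') Hz) as [E|E]; apply (f_equal (@proj1_sig _ _)) in E; auto.
- intros [->| ->]; [apply (proj2 (H a))|apply (proj2 (H b))]; auto.
Qed.

Lemma opair_absolute (c a b : inner V) : is_opair c a b ->
  is_opair (proj1_sig c : background) (proj1_sig a) (proj1_sig b).
Proof.
intros H z; split.
- intro Hz; pose (z' := exist V z (V_transitive (proj2_sig c) Hz) : inner V).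
  destruct (proj1 (H z') Hz) as [E|E]; apply upair_absolute in E; auto.
- destruct (zfc_pairing V_ZFC a a) as [d Hd], (zfc_pairing V_ZFC a b) as [d' Hd'].
  intros [E|E].
  + assert (z = proj1_sig d) as ->; [|apply (proj2 (H d)); auto].
    apply hset_ext; intro w; rewrite (E w), (upair_absolute Hd w); tauto.
  + assert (z = proj1_sig d') as ->; [|apply (proj2 (H d')); auto].
    apply hset_ext; intro w; rewrite (E w), (upair_absolute Hd' w); tauto.
Qed.

(** Places every element of a function from [n] to [V] in [V], so that the truth lemma applies to
    it. *)
Lemma opair_in_model (z : background) (a b : inner V) :
  is_opair z (proj1_sig a : background) (proj1_sig b) ->
  exists c : inner V, z = proj1_sig c /\ is_opair c a b.
Proof.
intro H; destruct (opair_exists V_ZFC a b) as [c Hc]; exists c; split; trivial.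
apply hset_ext; intro w; rewrite (H w), (opair_absolute Hc w); tauto.
Qed.

End Absoluteness.

(** * Names for short functions over a bounded part of the product *)

Lemma function_in_bounded_extension (V : background -> Prop)
    (V_transitive : transitive_class V) (V_ZFC : ZFC (inner V))
    (gamma : inner V) (gamma_ordinal : is_ordinal gamma)
    (F : family (inner V)) (P : forcing (inner V))
    (P_product : product_forcing gamma F P)
    (P_bounded : bounded_support gamma F P)
    (kappa : inner V) (kappa_cf : is_cofinality kappa gamma)
    (P_cc : chain_condition P kappa)
    (G : inner V -> Prop) (G_generic : is_generic P G)
    (n : inner V) (Hn : n ∈ kappa) (f : background) :
  functions_in V (extension (fun p => p ∈ cond P) G) (proj1_sig n) f ->
  exists a : inner V, a ∈ gamma /\
    extension (restrict gamma F (fun p => p ∈ cond P) a) (restrict gamma F G a) f.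
Proof.
intros ((t & Nt & Ht) & (f_pairs & f_total) & f_V).
pose proof (prod_forcing P_product) as P_forcing.
pose proof (@inner_wf V) as V_wf.
destruct (valuation V_ZFC G) as (val & valE & val_value).
apply val_value in Ht.
(* [p] forces [u] into the name [t]; the name of [f] below will be
   [tau = {(check u, p) : Q p u, p = p|d}]. *)
pose (Q p (u : inner V) := p ∈ cond P /\
  exists s q, related t s q /\ le P p q /\ forces_eq P s p u).
assert (D_Q : forall a b, definable_term a -> definable_term b ->
    definable (fun e => Q (a e) (b e))).
{ intros a b; apply definable_rel2; unfold Q; definable. }
assert (Q_le : forall p q u, Q p u -> le P q p -> Q q u).
{ intros p q u (Hp & s & r & Hs & L & K) L'; split; [exact (le_dom P_forcing L')|].
  exists s, r; repeat split; trivial; [exact (le_trans P_forcing L' L)|].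
  exact (forces_eq_le V_ZFC V_wf P_forcing K L'). }
assert (f_Q : forall u : inner V, proj1_sig u ∈ f <-> exists p, G p /\ Q p u).
{ intro u; rewrite Ht, valE; split.
  - intros (s & q & Gq & Hs & E).
    destruct (forces_eq_complete V_transitive V_ZFC P_forcing G_generic valE (eq_sym E))
      as (p & Gp & K).
    destruct (generic_directed G_generic Gp Gq) as (r & Gr & L & L').
    exists r; split; [trivial|split; [exact (generic_cond G_generic Gr)|]].
    exists s, q; repeat split; trivial.
    exact (forces_eq_le V_ZFC V_wf P_forcing K L).
  - intros (p & Gp & _ & s & q & Hs & L & K); exists s, q.
    split; [exact (generic_up G_generic Gp L)|split; trivial]; symmetry.
    exact (forces_eq_sound V_transitive V_ZFC P_forcing G_generic valE Gp K). }
assert (f_model : forall u, u ∈ f -> exists (c x y : inner V),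
    u = proj1_sig c /\ is_opair c x y /\ x ∈ n).
{ intros u Hu; destruct (f_pairs u Hu) as (x & y & Hx & Hxy).
  assert (Hy : related f x y) by (exists u; auto).
  pose (x' := exist V x (V_transitive _ _ (proj2_sig n) Hx) : inner V).
  pose (y' := exist V y (f_V x y Hy) : inner V).
  destruct (opair_in_model V_transitive V_ZFC (a := x') (b := y') Hxy) as (c & E & Hc).
  exists c, x', y'; auto. }
(* [D x] consists of the conditions deciding the value at [x]: they force some pair with first
   coordinate [x] into [t]. *)
pose (D x p := exists u y, is_opair u x y /\ Q p u).
destruct (bounded_predense_family V_ZFC V_wf P_forcing gamma_ordinal kappa_cf P_cc
  (bounded := fun p d => is_restriction gamma F p p d)) with (n := n) (D := D)
  as (d & Hd & d_predense); trivial.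
{ definable. }
{ intros p a b; apply restriction_mono. }
{ unfold D; definable. }
{ intros x p (u & y & _ & Hp & _); exact Hp. }
pose proof (proj1 gamma_ordinal d Hd) as d_sub.
exists d; split; trivial.
destruct (restrict_one P_product d_sub (proj1 G_generic)) as (one & C_one & G_one).
destruct (check_names V_ZFC one) as (check & D_check & checkE & check_related).
assert (D_check' : forall a b, definable_term a -> definable_term b ->
    definable (fun e => check (a e) = b e)).
{ intros a b; apply (definable_rel2 (R := fun x y => check x = y)), D_check. }
(* For [tau] to be a set, its check names must come from a set. A name in the transitive set [T] and
   a condition determine at most one [u], so replacement collects the relevant check names in
   [B]. *)
destruct (zfc_pairing V_ZFC t t) as [tt Htt].
destruct (closure_exists V_ZFC V_wf tt) as (T & (T_trans & T_sub & _) & _).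
assert (tT : t ∈ T) by (apply T_sub, Htt; auto).
destruct (pairs_bounded V_ZFC T (cond P)) as [S HS].
destruct (replacement V_ZFC (R := fun w c => exists s p u,
  is_opair w s p /\ forces_eq P s p u /\ check u = c) (a := S)) as [B HB]; [definable| |].
{ intros w c c' _ (s & p & u & Hw & K & <-) (s' & p' & u' & Hw' & K' & <-).
  destruct (opair_inj V_ZFC Hw Hw') as [<- <-].
  rewrite (forces_eq_unique V_ZFC V_wf P_forcing K K'); reflexivity. }
destruct (relation_set V_ZFC (R := fun c p => exists u,
  check u = c /\ Q p u /\ is_restriction gamma F p p d) B (cond P))
  as (tau & tau_pairs & tauE); [definable|].
destruct (valuation V_ZFC (restrict gamma F G d)) as (val' & val'E & val'_value).
assert (val'_check : forall u, val' (check u) = proj1_sig u).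
{ intro u; induction (V_wf u) as [u _ IH]; apply hset_ext; intro z; rewrite val'E; split.
  - intros (s & p & _ & Hs & ->); apply check_related in Hs.
    destruct Hs as (_ & v & Hv & ->); rewrite IH; trivial.
  - intro Hz; pose (v := exist V z (V_transitive _ _ (proj2_sig u) Hz) : inner V).
    exists (check v), one; split; [trivial|split].
    + apply check_related; split; trivial; exists v; auto.
    + symmetry; apply (IH v Hz). }
exists tau; split; [|apply val'_value].
- split.
  + intros z Hz; destruct (tau_pairs z Hz) as (c & p & Hzcp & _ & Hp & u & _ & _ & Bp).
    exists c, p; split; trivial; exists p; auto.
  + intros c p Hc; apply tauE in Hc; destruct Hc as (_ & _ & u & <- & _).
    clear - V_wf checkE check_related C_one.
    induction (V_wf u) as [u _ IH]; split.
    * intros z Hz; apply checkE in Hz; destruct Hz as (v & Hv & Hz).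
      exists (check v), one; auto.
    * intros s p Hs; apply check_related in Hs; destruct Hs as (-> & v & Hv & ->); auto.
- apply hset_ext; intro w; rewrite val'E; split.
  + intro Hw; destruct (f_model w Hw) as (u & x & y & -> & Hu & Hx).
    destruct (proj1 (f_Q u) Hw) as (p & Gp & Qp).
    assert (Dp : D x p) by (exists u, y; auto).
    (* An extension of [p] still decides the value at [x], so it is compatible with a deciding [a]
       supported in [d]. The conditions below such an [a] are therefore dense below [p], and [G]
       contains some [a]. *)
    destruct (generic_meets V_ZFC P_forcing G_generic (p := p) (A := fun q =>
      exists a, D x a /\ is_restriction gamma F a a d /\ le P q a))
      as (q & Gq & a & Da & Ba & L); [unfold D; definable|trivial| |].
    { intros p' L; destruct (d_predense x p') as (a & Da & Ba & r & Hr & L1 & L2); trivial.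
      - exists u, y; split; trivial; exact (Q_le p p' u Qp L).
      - exists r; split; trivial; exists a; auto. }
    pose proof (generic_up G_generic Gq L) as Ga.
    destruct Da as (u' & y' & Hu' & Qa).
    assert (Hw' : proj1_sig u' ∈ f) by (apply f_Q; exists a; auto).
    (* The condition [a] was not chosen to decide the same pair as [p]; but both pairs belong to
       [f], which has one value at [x]. *)
    assert (u' = u) as ->.
    { destruct (f_total (proj1_sig x) Hx) as (v & _ & U).
      assert (E : y' = y).
      { assert (E : proj1_sig y' = proj1_sig y).
        { rewrite <- (U (proj1_sig y)), (U (proj1_sig y')); trivial.
          - exists (proj1_sig u'); split; trivial.
            exact (opair_absolute V_transitive V_ZFC Hu').
          - exists (proj1_sig u); split; trivial.
            exact (opair_absolute V_transitive V_ZFC Hu). }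
        destruct y, y'; simpl in E; subst; f_equal; apply proof_irrelevance. }
      subst y'; exact (opair_unique V_ZFC Hu' Hu). }
    exists (check u), a; split; [exists a; auto|split; [|symmetry; apply val'_check]].
    apply tauE; split; [|split; [apply Qa|exists u; auto]].
    destruct Qa as (Ha & s & q' & Hs & _ & K); apply HB.
    destruct (opair_exists V_ZFC s a) as [z Hz]; exists z; split.
    * apply (HS z s a Hz); trivial; exact (transitive_related V_ZFC T_trans tT Hs).
    * exists s, a, u; auto.
  + intros (c & p & Gp & Hc & ->); apply tauE in Hc.
    destruct Hc as (_ & Hp & u & <- & Qp & Bp); rewrite val'_check; apply f_Q.
    exists p; split; trivial.
    apply (restrict_filter V_ZFC P_product d_sub (proj1 G_generic)); [exists p; auto|trivial].
Qed.

Theorem proposition1p3 (V : background -> Prop) (V_transitive : transitive_class V)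
    (V_ZFC : ZFC (inner V))
    (gamma : inner V) (gamma_ordinal : is_ordinal gamma)
    (F : family (inner V)) (P : forcing (inner V))
    (P_product : product_forcing gamma F P)
    (P_bounded : bounded_support gamma F P)
    (kappa : inner V) (kappa_cf : is_cofinality kappa gamma) :
  chain_condition P kappa -> is_final gamma F P kappa.
Proof.
intros P_cc G G_generic n Hn f; split.
- intro Hf; pose proof (function_in_bounded_extension V_transitive V_ZFC gamma_ordinal
    P_product P_bounded kappa_cf P_cc G_generic Hn Hf) as (a & Ha & Ef).
  exists a; split; [trivial|split; [exact Ef|apply Hf]].
(* Conversely, [P|a] is part of [P] and [G|a] agrees with [G] on it. *)
- intros (a & Ha & Ef & Hf); split; [|exact Hf].
  pose proof (proj1 gamma_ordinal a Ha) as a_sub.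
  apply (extension_mono V_ZFC) with (3 := Ef).
  + intros p; apply (restrict_cond V_ZFC P_product a_sub).
  + intros p; apply (restrict_filter V_ZFC P_product a_sub (proj1 G_generic)).
Qed.
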